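(* Let $I$ be a squarefree quasi-equigenerated monomial ideal in a polynomial ring over a field $k$, and let $\mathcal I\subseteq k[T_1,\dots,T_t]$ be the defining ideal of its fiber cone $F(I)$. Then $I$ is a Freiman ideal if and only if $\mathcal I$ is either $(0)$ or it is generated by the $2\times2$ minors of a generic $2\times m$ matrix (for some $m\ge 2$).
   Context: Let $R=k[x_1,\dots,x_n]$, $\mathfrak m=(x_1,\dots,x_n)$, and let $I\subseteq R$ be a monomial ideal with minimal monomial generators $f_1,\dots,f_t$, $f_j=\prod_{i=1}^n x_i^{c_{ij}}$. $I$ is squarefree if all $f_j$ are squarefree. $I$ is quasi-equigenerated if there is $\alpha=(a_1,\dots,a_n)$ with all $a_i$ positive integers such that $\sum_{i=1}^n a_i c_{ij}$ is the same for all $j$. The fiber cone is $F(I)=\bigoplus_{i\ge0}I^i/\mathfrak m I^i$; the analytic spread $l(I)$ is its Krull dimension; $\mu(\cdot)$ is the minimal number of generators. The defining ideal $\mathcal I$ is the kernel of the surjection $k[T_1,\dots,T_t]\to F(I)$ sending $T_i$ to the class of $f_i$ in $I/\mathfrak m I$. A quasi-equigenerated monomial ideal $I$ is a Freiman ideal if $\mu(I^2)=l(I)\mu(I)-\binom{l(I)}{2}$. A $2\times m$ matrix is called generic here if its $2m$ entries are pairwise distinct variables among $T_1,\dots,T_t$ (not all the variables need to occur). *)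

(* Defs.v *)
From HB Require Import structures.
From mathcomp Require Import all_boot all_order all_algebra.
From mathcomp Require Import boolp.
From mathcomp Require Import mpoly.

Set Implicit Arguments.
Unset Strict Implicit.
Unset Printing Implicit Defensive.

Import GRing.Theory.
Local Open Scope quotient_scope.
Local Open Scope ring_scope.

(* An ideal is a {pred A}; the classical truth value `[< P >] makes any
   property P of ring elements such a predicate. *)
Section Ideals.
Variable A : comNzRingType.
Implicit Types (S I J : {pred A}).

Definition ideal_gen S : {pred A} := fun p =>
  `[< exists2 s : seq (A * A), all [pred x | x.2 \in S] s
                             & p = \sum_(x <- s) x.1 * x.2 >].

Definition idealM I J : {pred A} :=
  ideal_gen (fun p => `[< exists2 x, x \in I & exists2 y, y \in J & p = x * y >]).

Definition idealX I (i : nat) : {pred A} := iter i (idealM I) predT.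

Definition generated_by I (r : nat) : Prop :=
  exists g : r.-tuple A, I =i ideal_gen (mem g).

Definition min_num_gens I (r : nat) : Prop :=
  generated_by I r /\ forall s, generated_by I s -> (r <= s)%N.

Definition prime_ideal (P : {pred A}) : Prop :=
  idealr_closed P /\ prime_idealr_closed P.

Definition prime_chain (d : nat) (P : 'I_d.+1 -> {pred A}) : Prop :=
  (forall i, prime_ideal (P i)) /\
  (forall i j : 'I_d.+1, (i < j)%N ->
     {subset P i <= P j} /\ ~ {subset P j <= P i}).

End Ideals.

Definition krull_dim (A : comNzRingType) (d : nat) : Prop :=
  (exists P : 'I_d.+1 -> {pred A}, prime_chain P) /\
  (forall e (P : 'I_e.+1 -> {pred A}), prime_chain P -> (e <= d)%N).

Section IdealFacts.
Variable A : comNzRingType.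
Implicit Types (S I J : {pred A}).

Lemma ideal_gen_mem S x : x \in S -> x \in ideal_gen S.
Proof.
move=> Sx; apply/asboolP; exists [:: (1, x)]; first by rewrite /= Sx.
by rewrite big_seq1 mul1r.
Qed.

Lemma ideal_gen0 S : 0 \in ideal_gen S.
Proof. by apply/asboolP; exists [::]; rewrite ?big_nil. Qed.

Lemma ideal_genD S x y :
  x \in ideal_gen S -> y \in ideal_gen S -> x + y \in ideal_gen S.
Proof.
move=> /asboolP[s Ss ->] /asboolP[u Su ->]; apply/asboolP.
by exists (s ++ u); rewrite ?all_cat ?Ss // big_cat.
Qed.

Lemma ideal_genMl S a x : x \in ideal_gen S -> a * x \in ideal_gen S.
Proof.
move=> /asboolP[s Ss ->]; apply/asboolP.
exists [seq (a * z.1, z.2) | z <- s]; first by rewrite all_map.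
by rewrite big_map big_distrr; apply: eq_bigr => z _; rewrite /= mulrA.
Qed.

Lemma ideal_gen_sum S (T : Type) (r : seq T) (P : pred T) (F : T -> A) :
  (forall i, P i -> F i \in ideal_gen S) ->
  \sum_(i <- r | P i) F i \in ideal_gen S.
Proof.
by move=> SF; apply: (big_ind (fun z => z \in ideal_gen S)) => //;
  [exact: ideal_gen0 | exact: ideal_genD].
Qed.

Lemma ideal_gen_ind S (Q : A -> Prop) :
    Q 0 -> (forall x y, Q x -> Q y -> Q (x + y)) ->
    (forall a x, x \in S -> Q (a * x)) ->
  forall x, x \in ideal_gen S -> Q x.
Proof.
move=> Q0 QD QS x /asboolP[s Ss ->]; elim: s Ss => [|z s IHs] /=.
  by rewrite big_nil.
by case/andP=> Sz /IHs Qs; rewrite big_cons; apply: QD => //; apply: QS.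
Qed.

Lemma idealM_mem I J x y : x \in I -> y \in J -> x * y \in idealM I J.
Proof.
by move=> Ix Jy; apply: ideal_gen_mem; apply/asboolP; exists x => //; exists y.
Qed.

Lemma idealX0_mem I x : x \in idealX I 0. Proof. by []. Qed.

Lemma idealX1_mem I x : x \in I -> x \in idealX I 1.
Proof. by move=> Ix; rewrite -[x]mulr1; apply: idealM_mem. Qed.

Lemma idealX_0 I i : 0 \in idealX I i.
Proof. by case: i => [|i] //; apply: ideal_gen0. Qed.

Lemma idealX_add I i x y :
  x \in idealX I i -> y \in idealX I i -> x + y \in idealX I i.
Proof. by case: i => [|i] //; apply: ideal_genD. Qed.

Lemma idealX_mulr I i a x : x \in idealX I i -> a * x \in idealX I i.
Proof. by case: i => [|i] //; apply: ideal_genMl. Qed.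

Lemma idealX_mul I i j x y :
  x \in idealX I i -> y \in idealX I j -> x * y \in idealX I (i + j)%N.
Proof.
move=> + Jy; elim: i x => [|i IHi] x; first by move=> _; apply: idealX_mulr.
move: x; apply: ideal_gen_ind.
- by rewrite mul0r idealX_0.
- by move=> u v Iu Iv; rewrite mulrDl idealX_add.
move=> a _ /asboolP[u Iu [v Iv ->]]; rewrite -!mulrA idealX_mulr //.
by rewrite addSn; apply: idealM_mem => //; apply: IHi.
Qed.

Lemma idealM_idealX_mul J I i j x y :
    x \in idealX I i -> y \in idealM J (idealX I j) ->
  x * y \in idealM J (idealX I (i + j)%N).
Proof.
move=> Ix; move: y; apply: ideal_gen_ind.
- by rewrite mulr0 ideal_gen0.
- by move=> u v Iu Iv; rewrite mulrDr ideal_genD.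
move=> a _ /asboolP[u Ju [v Iv ->]]; rewrite mulrCA ideal_genMl //.
by rewrite mulrCA; apply: idealM_mem => //; apply: idealX_mul.
Qed.

End IdealFacts.

(* The Rees algebra \bigoplus_i I^i, as the subring of A[X] of the
   polynomials whose coefficient of 'X^i lies in I^i. *)
Section Rees.
Variables (A : comNzRingType) (I : {pred A}).

Definition rees_pred : {pred {poly A}} := fun p =>
  `[< forall i, p`_i \in idealX I i >].

Lemma rees_subring : subring_closed rees_pred.
Proof.
split=> [|p q /asboolP Ip /asboolP Iq|p q /asboolP Ip /asboolP Iq];
  apply/asboolP=> i.
- by rewrite coef1; case: i => // i; rewrite idealX_0.
- by rewrite coefB -mulN1r idealX_add ?idealX_mulr.
rewrite coefM; apply: (big_ind (fun z => z \in idealX I i)).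
- exact: idealX_0.
- exact: idealX_add.
move=> j _; have le_ji : (j <= i)%N by rewrite -ltnS ltn_ord.
by have := idealX_mul (Ip j) (Iq (i - j)%N); rewrite subnKC.
Qed.

HB.instance Definition _ := GRing.isSubringClosed.Build {poly A} rees_pred
  rees_subring.

Record rees : Type := Rees { rees_val : {poly A}; _ : rees_val \in rees_pred }.

HB.instance Definition _ := [isSub for rees_val].
HB.instance Definition _ := [Choice of rees by <:].
HB.instance Definition _ := [SubChoice_isSubComNzRing of rees by <:].

Lemma rees_const_subproof (a : A) : a%:P \in rees_pred.
Proof.
by apply/asboolP => -[|i]; rewrite coefC //; exact: idealX_0.
Qed.

Definition rees_const (a : A) : rees := Rees (rees_const_subproof a).

Lemma rees_deg1_subproof (x : A) (Ix : x \in I) : x *: 'X \in rees_pred.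
Proof.
apply/asboolP=> -[|[|i]]; rewrite coefZ coefX ?mulr1 ?mulr0 //.
- exact: idealX1_mem.
- exact: idealX_0.
Qed.

(* x \in I, placed in degree 1 *)
Definition rees_deg1 (x : A) (Ix : x \in I) : rees :=
  Rees (rees_deg1_subproof Ix).

End Rees.

Section FiberCone.
Variables (k : fieldType) (n : nat).
Local Notation R := {mpoly k[n]}.

Definition max_ideal : {pred R} :=
  ideal_gen (mem (codom (fun i : 'I_n => 'X_i : R))).

Lemma max_ideal_coef0 (p : R) : p \in max_ideal -> p@_0%MM = 0.
Proof.
move: p; apply: ideal_gen_ind => [|u v u0 v0|a _ /codomP[i ->]].
- by rewrite mcoeff0.
- by rewrite mcoeffD u0 v0 addr0.
by rewrite rmorphM /= mcoeffX mnm1_eq0 mulr0.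
Qed.

Variable I : {pred R}.

(* \bigoplus_i m I^i, inside the Rees algebra of I *)
Definition fiber_ideal : {pred rees I} := fun p =>
  `[< forall i, (rees_val p)`_i \in idealM max_ideal (idealX I i) >].

Lemma fiber_ideal_idealr_closed : idealr_closed fiber_ideal.
Proof.
split.
- by apply/asboolP=> i; rewrite coef0 ideal_gen0.
- apply/negP => /asboolP/(_ 0%N); rewrite coef1 /= => m1.
  suff /max_ideal_coef0/eqP: (1 : R) \in max_ideal by rewrite mcoeff1 eqxx oner_eq0.
  move: (1 : R) m1; apply: ideal_gen_ind; first exact: ideal_gen0.
    by move=> u v; apply: ideal_genD.
  move=> b _ /asboolP[u mu [v _ ->]].
  by rewrite ideal_genMl // mulrC ideal_genMl.
move=> a p q /asboolP Ip /asboolP Iq; apply/asboolP=> i.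
rewrite coefD ideal_genD //= coefM; apply: ideal_gen_sum => j _.
have le_ji : (j <= i)%N by rewrite -ltnS ltn_ord.
have /asboolP Ia := valP a.
by have := idealM_idealX_mul (Ia j) (Ip (i - j)%N); rewrite subnKC.
Qed.

HB.instance Definition _ := isIdealr.Build (rees I) fiber_ideal
  fiber_ideal_idealr_closed.

(* F(I) = \bigoplus_i I^i / m I^i *)
Definition fiber_cone : comNzRingType := {ideal_quot fiber_ideal}.

Definition fiber_class (p : rees I) : fiber_cone :=
  \pi_({ideal_quot fiber_ideal}) p.

Definition analytic_spread (l : nat) : Prop := krull_dim fiber_cone l.

End FiberCone.

Arguments max_ideal k n.
Arguments fiber_ideal {k n} I.

(* A monomial ideal is given by the family f of the exponent vectors of its
   monomial generators: f j i is the exponent c_ij of x_i in f_j. *)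
Section MonomialIdeals.
Variables (k : fieldType) (n t : nat) (f : 'I_t -> 'X_{1..n}).

Definition monomial_ideal : {pred {mpoly k[n]}} :=
  ideal_gen (mem (codom (fun j => 'X_[f j]))).

Definition minimal_generators : Prop :=
  forall j, 'X_[f j] \notin
    ideal_gen (mem [seq ('X_[f i] : {mpoly k[n]}) | i : 'I_t in predC1 j]).

Definition squarefree_monomials : Prop := forall j i, (f j i <= 1)%N.

Definition quasi_equigenerated : Prop :=
  exists a : 'I_n -> nat, (forall i, (0 < a i)%N) /\
    forall j1 j2, (\sum_i a i * f j1 i = \sum_i a i * f j2 i)%N.

Definition freiman : Prop :=
  quasi_equigenerated /\
  exists l mu1 mu2 : nat,
    [/\ analytic_spread monomial_ideal l,
        min_num_gens monomial_ideal mu1,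
        min_num_gens (idealX monomial_ideal 2) mu2
      & mu2%:Z = l%:Z * mu1%:Z - 'C(l, 2)%:Z].

Lemma monomial_ideal_gen j : 'X_[f j] \in monomial_ideal.
Proof. by apply: ideal_gen_mem; apply: codom_f. Qed.

Definition fiber_map : {mpoly k[t]} -> fiber_cone monomial_ideal :=
  mmap (fun c : k => fiber_class (rees_const monomial_ideal c%:MP))
       (fun j => fiber_class (rees_deg1 (monomial_ideal_gen j))).

Definition defining_ideal : {pred {mpoly k[t]}} := fun p => fiber_map p == 0.

End MonomialIdeals.

Arguments monomial_ideal k {n t} f.
Arguments defining_ideal k {n t} f.

Section Determinantal.
Variables (k : fieldType) (t m : nat).

Definition generic_matrix (M : 'M[{mpoly k[t]}]_(2, m)) : Prop :=
  exists2 v : 'I_2 * 'I_m -> 'I_t, injective v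
    & M = \matrix_(i, j) 'X_(v (i, j)).

Definition minors2 (M : 'M[{mpoly k[t]}]_(2, m)) : {pred {mpoly k[t]}} :=
  fun q => [exists g : {ffun 'I_2 -> 'I_m},
              (g ord0 < g ord_max)%N && (q == \det (colsub g M))].

End Determinantal.

(* Main.v *)
From HB Require Import structures.
Require Import Defs.
From mathcomp Require Import all_boot all_order all_algebra.
From mathcomp Require Import ring zify.
From mathcomp Require Import boolp.
From mathcomp Require Import mpoly.

(* Since I is quasi-equigenerated, F(I) is the toric ring of the 0/1 vectors
   (f_j, 1).  Its Krull dimension is their rank l: setting the variables to 1
   one after the other gives a chain of l + 1 toric primes, and a chain of
   primes yields algebraically independent elements of a polynomial ring in l
   variables.  Moreover mu(I^2) is the number of sums of two of the vectors.

   Removing a vector p from a set S of 0/1 vectors loses at least rk S sums, as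
   the q such that p + q is not a sum of two other vectors span S (induction on
   the Hamming distance to p).  Hence #|2S| + C(d + 1, 2) >= C(#|S| + 1, 2) for
   d = #|S| - rk S, and the Freiman condition is equality.  Adding the vectors
   one by one and keeping track of the few possible coincidences p + q = r + s
   shows that equality forces S to be independent, or to consist of A, of a
   translate A + w and of further vectors, with rk S = #|S| - #|A| + 1.  The
   latter is exactly the situation in which the toric ideal is generated by the
   2-minors of the matrix with rows A and A + w. *)

Set Implicit Arguments.
Unset Strict Implicit.
Unset Printing Implicit Defensive.
Import Order.TTheory GRing.Theory Num.Theory.
Local Open Scope quotient_scope.
Local Open Scope ring_scope.

(** * Sumsets of 0/1 vectors *)

(** Ranks are taken over the rationals whatever [k] is: the kernel of a monomial map is spanned by
    binomials, so it depends only on the integer relations between exponent vectors, not on the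
    characteristic. The passage to a toric ring works because, for the weights [a], the products of
    [i] generators all have the same weight while everything in [m I^i] is strictly heavier. In the
    equality case the obstacle is that the last vector [p] may take part in coincidences unrelated
    to [A] and [A + w]. Two of them are compared after eliminating [p]. Since [S] without [A + w],
    together with [w], is a basis of the span, the comparison is an equality of multisets. It forces
    the wanted extension, except when [#|A| = 2], where [A] and [A + w] form a parallelogram that
    has to be read in its other direction. The converse requires no such analysis: an upper and a
    lower bound for the sumset meet. *)

Section Sumset.
Variables (T : finType) (N : nat) (g : T -> 'rV[rat]_N).
Implicit Types (S A : {set T}).

(* A sum g i + g j is encoded by the set of all pairs with the same sum, so
   that sumsets become finite sets. *)
Definition sum_class i j : {set T * T} :=
  [set z | g z.1 + g z.2 == g i + g j].

Definition sumset S : {set {set T * T}} := [set sum_class i j | i in S, j in S].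

Definition span S := (\sum_(i in S) <<g i>>)%MS.
Definition rk S := \rank (span S).

Lemma sum_classP i j i' j' :
  sum_class i j = sum_class i' j' <-> g i + g j = g i' + g j'.
Proof.
split=> [E|E]; last by apply/setP=> z; rewrite !inE E.
have: (i, j) \in sum_class i j by rewrite inE.
by rewrite E inE => /eqP.
Qed.

Lemma mem_sumset S i j :
  reflect (exists r s, [/\ r \in S, s \in S & g i + g j = g r + g s])
          (sum_class i j \in sumset S).
Proof.
apply: (iffP imset2P) => [[r s rS sS /sum_classP E]|[r [s [rS sS E]]]].
  by exists r, s.
by exists r s => //; apply/sum_classP.
Qed.

Lemma span_sub S i : i \in S -> (g i <= span S)%MS.
Proof. by move=> iS; apply: (sumsmx_sup i) => //; rewrite genmxE. Qed.

Lemma span_subP S m (V : 'M_(m, N)) :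
  (forall i, i \in S -> (g i <= V)%MS) -> (span S <= V)%MS.
Proof. by move=> H; apply/sumsmx_subP=> i /H; rewrite genmxE. Qed.

Lemma spanS S S' : S \subset S' -> (span S <= span S')%MS.
Proof. by move=> /subsetP sub; apply: span_subP => i /sub; apply: span_sub. Qed.

Lemma rk_le_card S : (rk S <= #|S|)%N.
Proof.
rewrite /rk /span -sum1_card; apply: leq_trans (mxrank_sum_leqif _).1 _.
by rewrite /=; apply: leq_sum => i _; rewrite mxrank_gen rank_leq_row.
Qed.

Lemma spanU1 S p : (span (p |: S) :=: <<g p>> + span S)%MS.
Proof.
apply/eqmxP/andP; split; last first.
  by rewrite addsmx_sub genmxE span_sub ?setU11 // spanS // subsetUr.
apply: span_subP => i /setU1P[->|iS].
  by apply: submx_trans (addsmxSl _ _); rewrite genmxE.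
by apply: submx_trans (addsmxSr _ _); apply: span_sub.
Qed.

Lemma rkU1_in S p : (g p <= span S)%MS -> rk (p |: S) = rk S.
Proof.
move=> pS; rewrite /rk spanU1; apply/eqP; rewrite eqn_leq !mxrankS ?addsmxSr //.
by rewrite addsmx_sub genmxE pS submx_refl.
Qed.

Lemma rkU1_leq S p : (rk (p |: S) <= (rk S).+1)%N.
Proof.
rewrite /rk spanU1; apply: leq_trans (mxrank_adds_leqif _ _).1 _.
by rewrite /= mxrank_gen -[leqRHS]add1n leq_add2r rank_leq_row.
Qed.

Lemma rkU1_notin S p : ~~ (g p <= span S)%MS -> rk (p |: S) = (rk S).+1.
Proof.
move=> pS; apply/eqP; rewrite eqn_leq rkU1_leq /=.
have sub : (span S <= span (p |: S))%MS by rewrite spanS // subsetUr.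
rewrite ltn_neqAle (mxrank_leqif_sup sub) (mxrank_leqif_sup sub).1 andbT.
by apply: contra pS => /(submx_trans _) -> //; rewrite span_sub ?setU11.
Qed.

Lemma span_lincomb S (v : 'rV_N) :
  (v <= span S)%MS -> exists c : T -> rat, v = \sum_(i in S) c i *: g i.
Proof.
case/sub_sumsmxP=> u ->.
have /fin_all_exists[c cE] i : exists c, u i *m <<g i>>%MS = c *: g i.
  by apply/sub_rVP; rewrite (submx_trans (submxMl _ _)) ?genmxE.
by exists c; apply: eq_bigr => i _; rewrite cE.
Qed.

Lemma rk_full_free S (c : T -> rat) : rk S = #|S| ->
  \sum_(i in S) c i *: g i = 0 -> forall i, i \in S -> c i = 0.
Proof.
move=> rkS E i iS; apply/eqP/negPn/negP=> nz.
have sub : (g i <= span (S :\ i))%MS.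
  have -> : g i = (c i)^-1 *: - (\sum_(j in S :\ i) c j *: g j).
    move: E; rewrite (big_setD1 i) //= => /eqP.
    by rewrite addr_eq0 => /eqP <-; rewrite scalerA mulVf ?scale1r.
  rewrite scalemx_sub // eqmx_opp.
  by apply: summx_sub => j jD; rewrite scalemx_sub ?span_sub.
have := rkU1_in sub; rewrite setD1K // rkS => E'.
by have := rk_le_card (S :\ i);
  rewrite -E' [X in (X <= _)%N](cardsD1 i) iS ltnn.
Qed.

(** Positive and negative parts of a rational relation become exponent vectors, so that linear
    dependence can be tested on binomials. *)
Lemma common_denominator (c : T -> rat) : exists d (u v : T -> nat),
  (0 < d)%N /\ forall i, d%:R * c i = (u i)%:R - (v i)%:R.
Proof.
pose d := (\prod_i `|denq (c i)|)%N.
have /fin_all_exists[uv uvE] i : exists uv : nat * nat,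
    d%:R * c i = uv.1%:R - uv.2%:R.
  pose e := (\prod_(j | j != i) `|denq (c j)|)%N.
  have -> : d%:R * c i = e%:R * (numq (c i))%:~R.
    rewrite numqE /d (bigD1 i) //= natrM -mulrA mulrC -mulrA; congr (_ * _).
    by rewrite -[in RHS]absz_denq pmulrn mulrC.
  case: (numq (c i)) => z.
    by exists ((e * z)%N, 0%N); rewrite subr0 natrM.
  by exists (0%N, (e * z.+1)%N); rewrite sub0r natrM NegzE mulrNz mulrN.
exists d, (fun i => (uv i).1), (fun i => (uv i).2); split=> //.
by rewrite prodn_gt0 // => i; rewrite absz_gt0 denq_neq0.
Qed.

Lemma set_ind1 (P : {set T} -> Prop) :
  P set0 -> (forall S p, p \notin S -> P S -> P (p |: S)) -> forall S, P S.
Proof.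
move=> P0 PS S; have [d] := ubnP #|S|; elim: d S => // d IH S;
  rewrite ltnS => hd.
have [->//|[p pS]] := set_0Vmem S.
rewrite -(setD1K pS); apply: PS; first by rewrite !inE eqxx.
by apply: IH; move: hd; rewrite (cardsD1 p) pS.
Qed.

(** Freeness is tested on equalities of sums with natural multiplicities, the form in which the
    binomials of a toric ideal are given. *)
Lemma rk_of_nat_free S :
    (forall u v : T -> nat, (forall i, i \notin S -> u i = v i) ->
       \sum_i g i *+ u i = \sum_i g i *+ v i -> u =1 v) ->
  rk S = #|S|.
Proof.
elim/set_ind1: S => [|S p pS IH] free; first by apply/eqP;
  rewrite cards0 -leqn0 -(cards0 T) rk_le_card.
have rkS : rk S = #|S|.
  by apply: IH => u v uv; apply: free => i; rewrite !inE => /norP[_ /uv].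
have [/span_lincomb[c gp]|pin] := boolP (g p <= span S)%MS; last first.
  by rewrite rkU1_notin // cardsU1 pS rkS.
have [d [u [v [d_gt0 uv]]]] := common_denominator c.
(* The [d] copies of [g p] go to the side of [v]; the two sides then have equal sums but differ at
   [p], since [d > 0]. *)
pose u' i := if i \in S then u i else 0%N.
pose v' i := if i \in S then v i else if i == p then d else 0%N.
have : u' =1 v'.
  apply: free => [i|]; first by rewrite !inE /u' /v' =>
    /norP[/negPf-> /negPf->].
  rewrite (bigID (mem S)) [RHS](bigID (mem S)) /= [X in _ + X]big1 =>
    [|i /negPf iS]; last by rewrite /u' iS.
  rewrite [X in _ = _ + X](bigD1 p) //= [X in _ + (_ + X)]big1 ?addr0 =>
    [|i /andP[/negPf iS /negPf ip]]; last by rewrite /v' iS ip.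
  rewrite /v' (negPf pS) eqxx -scaler_nat gp scaler_sumr -big_split /=.
  apply: eq_bigr => i iS; rewrite /u' iS scalerA uv scalerBl !scaler_nat.
  by rewrite addrC subrK.
by move/(_ p); rewrite /u' /v' (negPf pS) eqxx => d0; rewrite -d0 in d_gt0.
Qed.

(** * New sums created by one more vector *)

Hypothesis g_inj : injective g.

Definition indecomposable S p : {set T} :=
  [set q in p |: S | sum_class p q \notin sumset S].

(** A sum involving [p] is either old or some [p + q] with [q] indecomposable, and [sum_class p] is
    injective because [g] is. *)
Lemma card_sumsetU1 S p :
  #|sumset (p |: S)| = (#|sumset S| + #|indecomposable S p|)%N.
Proof.
have inj_p : injective (sum_class p).
  by move=> q q' /sum_classP/addrI/g_inj.
rewrite -(card_imset (mem (indecomposable S p)) inj_p).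
have -> : sumset (p |: S) = sumset S :|: sum_class p @: indecomposable S p.
  apply/setP=> c; rewrite inE; apply/imset2P/orP => [[i j]|].
    have [iS|iS] := boolP (i \in S); have [jS|jS] := boolP (j \in S).
    - by move=> _ _ ->; left; apply/mem_sumset; exists i, j.
    - rewrite !inE (negPf jS) orbF => _ /eqP-> ->.
      have -> : sum_class i p = sum_class p i by apply/sum_classP;
        rewrite addrC.
      case: (boolP (sum_class p i \in sumset S)); [by left|right].
      by apply: imset_f; rewrite !inE iS orbT.
    - rewrite !inE (negPf iS) orbF => /eqP-> _ ->.
      case: (boolP (sum_class p j \in sumset S)); [by left|right].
      by apply: imset_f; rewrite !inE jS orbT.
    - rewrite !inE (negPf iS) (negPf jS) !orbF => /eqP-> /eqP-> ->.
      case: (boolP (sum_class p p \in sumset S)); [by left|right].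
      by apply: imset_f; rewrite !inE eqxx.
  case=> [/imset2P[i j iS jS ->]|/imsetP[q]].
    by exists i j; rewrite ?inE ?iS ?jS ?orbT.
  by rewrite inE => /andP[qS _] ->; exists p q; rewrite ?setU11.
rewrite cardsU; suff -> : sumset S :&: sum_class p @: indecomposable S p = set0.
  by rewrite cards0 subn0.
apply/setP=> c; rewrite !inE; apply/negP=> /andP[cS /imsetP[q]].
by rewrite inE => /andP[_ /negP qS] E; apply: qS; rewrite -E.
Qed.

Hypothesis g01 : forall i x, (g i 0 x == 0) || (g i 0 x == 1).

Definition hamming p q := #|[set x | g p 0 x != g q 0 x]|.

Lemma sum_coord p q r s x : g p + g q = g r + g s ->
  g p 0 x + g q 0 x = g r 0 x + g s 0 x.
Proof. by move=> /(congr1 (fun M : 'rV_N => M 0 x)); rewrite !mxE. Qed.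

(** Where [p] and [q] agree, the values 0 and 1 force [r] to agree with them. A coordinate at which
    [s] differs from [p] separates [p] from [q] but not from [r]. *)
Lemma hamming_lt p q r s :
  g p + g q = g r + g s -> s != p -> (hamming p r < hamming p q)%N.
Proof.
move=> E sp; apply: proper_card; apply/properP; split.
  apply/subsetP=> x; rewrite !inE; apply: contra => /eqP pq.
  have := sum_coord x E; rewrite -pq.
  by case/orP: (g01 p x) => /eqP->; case/orP: (g01 r x) => /eqP->;
     case/orP: (g01 s x) => /eqP->.
have [x px|E'] := pickP (fun x => g p 0 x != g s 0 x); last first.
  case/negP: sp; apply/eqP/g_inj/rowP=> x; apply/esym/eqP.
  by have := E' x; move/negbFE.
exists x; rewrite !inE; move: px; have := sum_coord x E.
  by case/orP: (g01 p x) => /eqP->; case/orP: (g01 r x) => /eqP->;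
     case/orP: (g01 s x) => /eqP->; case/orP: (g01 q x) => /eqP->.
by case/orP: (g01 p x) => /eqP->; case/orP: (g01 r x) => /eqP->;
   case/orP: (g01 s x) => /eqP->; case/orP: (g01 q x) => /eqP->.
Qed.

(** A vertex of the cube is not the midpoint of two other vertices. *)
Lemma double_inj p r s : g p + g p = g r + g s -> r = p /\ s = p.
Proof.
move=> E; have H x := sum_coord x E.
split; apply: g_inj; apply/rowP=> x; move: (H x);
  by case/orP: (g01 p x) => /eqP->; case/orP: (g01 r x) => /eqP->;
     case/orP: (g01 s x) => /eqP->.
Qed.

(* A vector q whose sum with p is a sum r + s of other vectors is r + s - p,
   where r and s are closer to p: the indecomposable vectors span. *)
Lemma span_indecomposable S p :
  p \notin S -> (span (p |: S) <= span (indecomposable S p))%MS.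
Proof.
move=> pS.
have pI : p \in indecomposable S p.
  rewrite !inE eqxx /=; apply/mem_sumset=> -[r [s [rS _ /double_inj[rp _]]]].
  by rewrite -rp rS in pS.
apply: span_subP => q; have [d] := ubnP (hamming p q).
elim: d q => // d IH q; rewrite ltnS => hd qS.
have [qI|] := boolP (q \in indecomposable S p); first exact: span_sub.
rewrite inE qS /= negbK => /mem_sumset[r [s [rS sS E]]].
have -> : g q = g r + g s - g p by rewrite -E addrAC subrr add0r.
have neq u : u \in S -> u != p by apply: contraTneq => ->.
rewrite addmx_sub ?eqmx_opp ?span_sub // addmx_sub // IH ?inE ?rS ?sS ?orbT //.
  exact: leq_trans (hamming_lt E (neq _ sS)) hd.
by apply: leq_trans (hamming_lt _ (neq _ rS)) hd; rewrite E addrC.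
Qed.

Lemma rk_leq_indecomposable S p :
  p \notin S -> (rk (p |: S) <= #|indecomposable S p|)%N.
Proof.
move=> pS; apply: leq_trans (rk_le_card _).
by apply: mxrankS; apply: span_indecomposable.
Qed.

(** A coincidence [p + q = r + s] with [q] in [S] would put [p] in the span of [S]; for [q = p],
    [double_inj] would give [r = p]. *)
Lemma indecomposable_notin_span S p :
  ~~ (g p <= span S)%MS -> indecomposable S p = p |: S.
Proof.
move=> pS; apply/setP=> q; rewrite inE andb_idr // => qS.
apply/mem_sumset=> -[r [s [rS sS E]]]; case/negP: pS.
have [qS'|qS'] := boolP (q \in S).
  have -> : g p = g r + g s - g q by rewrite -E addrK.
  by rewrite !addmx_sub ?eqmx_opp ?span_sub.
move: qS; rewrite !inE (negPf qS') orbF => /eqP qp.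
by move: E; rewrite qp => /double_inj[<- _]; apply: span_sub.
Qed.

(** * The lower bound for the sumset and its equality case *)

Definition defect S := (#|S| - rk S)%N.

Lemma defectU1_in S p : p \notin S -> (g p <= span S)%MS ->
  defect (p |: S) = (defect S).+1.
Proof.
by move=> pS pin; rewrite /defect cardsU1 pS rkU1_in // add1n subSn ?rk_le_card.
Qed.

Lemma defectU1_notin S p : p \notin S -> ~~ (g p <= span S)%MS ->
  defect (p |: S) = defect S.
Proof. by move=> pS pin; rewrite /defect cardsU1 pS rkU1_notin // add1n subSS.
  Qed.

Lemma card_defect S : (rk S + defect S = #|S|)%N.
Proof. by rewrite subnKC ?rk_le_card. Qed.

(** Adding [p] raises the left side by [#|S| + 1]. If [p] is in the span, at least [rk S] sums are
    gained and the binomial of the defect grows by [defect S + 1]; otherwise all [#|S| + 1] sums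
    with [p] are new. *)
Lemma freiman_leq S :
  ('C(#|S|.+1, 2) <= #|sumset S| + 'C((defect S).+1, 2))%N.
Proof.
elim/set_ind1: S => [|S p pS IH]; first by rewrite cards0 bin_small.
have := rk_leq_indecomposable pS; have := card_defect (p |: S).
rewrite card_sumsetU1 cardsU1 pS add1n.
have [pin|pin] := boolP (g p <= span S)%MS.
  rewrite defectU1_in // => E le_rk.
  rewrite binS bin1 [X in (_ <= _ + X)%N]binS bin1; lia.
rewrite defectU1_notin // indecomposable_notin_span // cardsU1 pS add1n.
by move=> _ _; rewrite binS bin1; lia.
Qed.

(** For [l = rk S] and [t = #|S|] this is [#|2S| = l t - C(l, 2)], rewritten without subtraction. *)
Definition freiman_set S :=
  (#|sumset S| + 'C((defect S).+1, 2) = 'C(#|S|.+1, 2))%N.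

(** Equality for [p |: S] leaves no slack in the induction step of [freiman_leq]: exactly [rk S]
    elements are indecomposable. *)
Lemma freiman_setU1_in S p : p \notin S -> (g p <= span S)%MS ->
  freiman_set (p |: S) ->
  freiman_set S /\ (#|(p |: S) :\: indecomposable S p| = defect (p |: S))%N.
Proof.
rewrite /freiman_set => pS pin.
have := rk_leq_indecomposable pS; have := card_defect (p |: S).
have := freiman_leq S.
have sub : indecomposable S p \subset p |: S.
  by apply/subsetP=> x; rewrite inE => /andP[].
have := subset_leq_card sub.
rewrite card_sumsetU1 cardsD (setIidPr sub) cardsU1 pS add1n defectU1_in //.
rewrite (binS (defect S).+1) (binS #|S|.+1) !bin1.
by move=> H1 H2 H3 H4 H5; split; lia.
Qed.

Lemma freiman_setU1_notin S p : p \notin S -> ~~ (g p <= span S)%MS ->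
  freiman_set (p |: S) -> freiman_set S.
Proof.
rewrite /freiman_set => pS pin.
rewrite card_sumsetU1 indecomposable_notin_span // cardsU1 pS add1n.
by rewrite defectU1_notin // [('C(_.+2, 2))%N]binS bin1 => E; lia.
Qed.


(** * A set and its translate: coordinates *)

Lemma free_spanW (D : {set T}) (w : 'rV[rat]_N) (c : T -> rat) (e : rat) :
    (#|D| < \rank (span D + <<w>>)%MS)%N ->
    \sum_(i in D) c i *: g i + e *: w = 0 ->
  (forall i, i \in D -> c i = 0) /\ e = 0.
Proof.
move=> rkD E; split=> [i iD|]; apply/eqP/negPn/negP=> nz.
  have sub : (g i <= span (D :\ i) + <<w>>)%MS.
    have -> : g i = (c i)^-1 *: (- (\sum_(j in D :\ i) c j *: g j) - e *: w).
      move: E; rewrite (big_setD1 i) //= -addrA => /eqP.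
      by rewrite addr_eq0 opprD => /eqP <-; rewrite scalerA mulVf ?scale1r.
    rewrite scalemx_sub // addmx_sub_adds ?eqmx_opp ?scalemx_sub ?genmxE //.
    by apply: summx_sub => j jD; rewrite scalemx_sub ?span_sub.
  have : (\rank (span D + <<w>>)%MS <= \rank (span (D :\ i) + <<w>>)%MS)%N.
    apply: mxrankS; rewrite addsmx_sub addsmxSr andbT.
    apply: span_subP => j jD; have [->//|ji] := eqVneq j i.
    by apply: submx_trans (addsmxSl _ _); rewrite span_sub // !inE ji.
  have := (mxrank_adds_leqif (span (D :\ i)) <<w>>%MS).1.
  have := rk_le_card (D :\ i); have := rank_leq_row w; rewrite /rk mxrank_gen.
  by move: rkD; rewrite [#|D|](cardsD1 i) iD; lia.
have sub : (w <= span D)%MS.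
  have -> : w = e^-1 *: (- (\sum_(j in D) c j *: g j)).
    move: E; rewrite addrC => /eqP.
    by rewrite addr_eq0 => /eqP <-; rewrite scalerA mulVf ?scale1r.
  rewrite scalemx_sub // eqmx_opp.
  by apply: summx_sub => j jD; rewrite scalemx_sub ?span_sub.
have : (\rank (span D + <<w>>)%MS <= rk D)%N.
  by apply: mxrankS; rewrite addsmx_sub submx_refl genmxE.
by have := rk_le_card D; lia.
Qed.

Definition segre S A (phi : T -> T) w :=
  [/\ A \subset S, phi @: A \subset S, [disjoint A & phi @: A]
    & {in A, forall a, g (phi a) = g a + w}].

Section Segre.
Variables (S A : {set T}) (phi : T -> T) (w : 'rV[rat]_N).
Hypothesis seg : segre S A phi w.

(** In matrix terms [base x] is the column of [x] and [top x] its row. An element outside [phi @: A]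
    is its own base, hence the default value. *)
Definition base x := odflt x [pick a in A | phi a == x].
Definition top x := x \in phi @: A.

Lemma segre_inj : {in A &, injective phi}.
Proof.
case: seg => _ _ _ gphi a b aA bA E; apply: g_inj.
by apply: (addIr w); rewrite -!gphi // E.
Qed.

Lemma base_id x : ~~ top x -> base x = x.
Proof.
rewrite /base; case: pickP => //= a /andP[aA /eqP<-] /negP[].
exact: imset_f.
Qed.

Lemma base_phi a : a \in A -> base (phi a) = a.
Proof.
move=> aA; rewrite /base; case: pickP => [b /andP[bA /eqP /segre_inj->]//|].
by move/(_ a); rewrite aA eqxx.
Qed.

Lemma top_phi a : a \in A -> top (phi a).
Proof. exact: imset_f. Qed.

Lemma top_A a : a \in A -> top a = false.
Proof. by case: seg => _ _ /disjointFr dis _ /dis. Qed.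

Lemma base_A a : a \in A -> base a = a.
Proof. by move=> aA; rewrite base_id ?top_A. Qed.

Lemma topP x : top x -> exists2 a, a \in A & x = phi a.
Proof. by case/imsetP=> a; exists a. Qed.

Lemma segreE x : g x = g (base x) + w *+ top x.
Proof.
have [/topP[a aA ->]|/[dup] tx] := boolP (top x); last first.
  by move=> /base_id ->; rewrite addr0.
by case: seg => _ _ _ gphi; rewrite base_phi // gphi.
Qed.

Lemma base_top_inj x y : base x = base y -> top x = top y -> x = y.
Proof. by move=> E1 E2; apply: g_inj; rewrite segreE E1 E2 -segreE. Qed.

Lemma base_in x : x \in S -> base x \in S :\: phi @: A.
Proof.
case: seg => /subsetP sub _ _ _ xS; rewrite inE.
have [/topP[a aA ->]|tx] := boolP (top x).
  by rewrite base_phi // -/(top a) top_A // sub.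
by rewrite base_id // xS andbT.
Qed.

Lemma card_segre : (#|S :\: phi @: A| + #|A| = #|S|)%N.
Proof.
case: seg => _ sub _ _; rewrite cardsD (setIidPr sub) (card_in_imset segre_inj).
by rewrite subnK // -(card_in_imset segre_inj) subset_leq_card.
Qed.

Hypothesis rkS : #|A| = (defect S).+1.

(** As [#|A| = defect S + 1], the set [D] has [rk S - 1] elements and is free together with [w]. The
    coordinates of a sum in this basis are its column counts and its number of top entries. *)
Lemma segre_coord (u v : T -> nat) :
    \sum_(j in S) g j *+ u j = \sum_(j in S) g j *+ v j ->
  (forall i, i \in S -> ~~ top i ->
     \sum_(j in S | base j == i) u j = \sum_(j in S | base j == i) v j)%N /\
  (\sum_(j in S | top j) u j = \sum_(j in S | top j) v j)%N.
Proof.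
pose D := S :\: phi @: A.
have decomp (c : T -> nat) : \sum_(j in S) g j *+ c j =
    \sum_(i in D) (\sum_(j in S | base j == i) c j)%:R *: g i
    + (\sum_(j in S | top j) c j)%:R *: w.
  transitivity (\sum_(j in S) (g (base j) *+ c j + w *+ top j *+ c j)).
    by apply: eq_bigr => j _; rewrite -mulrnDl -segreE.
  rewrite big_split /=; congr (_ + _).
    rewrite (partition_big base (mem D)) /=; last exact: base_in.
    apply: eq_bigr => i iD; rewrite natr_sum scaler_suml.
    by apply: eq_bigr => j /andP[_ /eqP->]; rewrite scaler_nat.
  rewrite natr_sum scaler_suml [RHS]big_mkcondr /=; apply: eq_bigr => j _.
  by case: (top j); rewrite ?mul0rn // scaler_nat.
pose ci (c : T -> nat) i := (\sum_(j in S | base j == i) c j)%N.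
pose ct (c : T -> nat) := (\sum_(j in S | top j) c j)%N.
move=> E; have : \sum_(i in D) ((ci u i)%:R - (ci v i)%:R) *: g i
    + ((ct u)%:R - (ct v)%:R) *: w = 0.
  move/eqP: E; rewrite !decomp -subr_eq0 opprD addrACA -scalerBl -sumrB.
  move=> /eqP E0; rewrite -[RHS]E0; congr (_ + _).
  by apply: eq_bigr => i _; rewrite scalerBl.
case/free_spanW.
  have := card_segre; have := card_defect S; rewrite -/D.
  suff : (rk S <= \rank (span D + <<w>>)%MS)%N by lia.
  apply: mxrankS; apply: span_subP => x xS; rewrite segreE.
  rewrite addmx_sub_adds ?span_sub ?base_in //.
  by rewrite -scaler_nat scalemx_sub ?genmxE.
move=> H1 H2; split=> [i iS ti|].
  by apply/eqP; rewrite -(eqr_nat rat) -subr_eq0 H1 // inE iS andbT.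
by apply/eqP; rewrite -(eqr_nat rat) -subr_eq0 H2.
Qed.

(** Three terms on each side are what remains when [p] is eliminated from two coincidences
    [p + q = r + s]. *)
Lemma segre_coord3 a1 a2 a3 b1 b2 b3 :
    [/\ a1 \in S, a2 \in S & a3 \in S] -> [/\ b1 \in S, b2 \in S & b3 \in S] ->
    g a1 + g a2 + g a3 = g b1 + g b2 + g b3 ->
  (forall i, (base a1 == i) + (base a2 == i) + (base a3 == i) =
     (base b1 == i) + (base b2 == i) + (base b3 == i))%N /\
  (top a1 + top a2 + top a3 = top b1 + top b2 + top b3)%N.
Proof.
move=> [a1S a2S a3S] [b1S b2S b3S] E.
have E1 x : x \in S -> g x = \sum_(j in S) g j *+ (j == x).
  move=> xS; rewrite (bigD1 x) //= eqxx big1 ?addr0 // => j /andP[_ /negPf->].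
  by rewrite mulr0n.
have := @segre_coord (fun j => (j == a1) + (j == a2) + (j == a3))%N
                     (fun j => (j == b1) + (j == b2) + (j == b3))%N.
have E2 x (P : pred T) : x \in S -> (\sum_(j in S | P j) (j == x) = P x)%N.
  move=> xS; case: (boolP (P x)) => Px.
    rewrite (bigD1 x) /= ?xS ?Px // eqxx big1 // => j.
    by move=> /andP[_ /negPf->].
  by rewrite big1 // => j /andP[_ Pj]; case: eqVneq Pj => // ->;
    rewrite (negPf Px).
case.
  under eq_bigr do rewrite !mulrnDr.
  under [RHS]eq_bigr do rewrite !mulrnDr.
  by rewrite !big_split /= -!E1.
move=> H1; rewrite !big_split /= !E2 // => H2; split=> // i.
have [iD|iD] := boolP (i \in S :\: phi @: A).
  move: iD; rewrite inE => /andP[ti iS].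
  by have := H1 i iS ti; rewrite !big_split /= !E2.
have F x : x \in S -> (base x == i) = false.
  by move=> /base_in xD; apply: contraNF iD => /eqP<-.
by rewrite !F.
Qed.

End Segre.

(** * Coincidences with a new vector, and the growth of the translated set *)

Lemma decomposableP S p q :
    p \notin S -> q \in (p |: S) :\: indecomposable S p ->
  q \in S /\ exists r s, [/\ r \in S, s \in S, g p + g q = g r + g s,
                            r != s & (r != q) /\ (s != q)].
Proof.
move=> pS; rewrite in_setD => /andP[]; rewrite inE negb_and negbK => qI qS.
move: qI; rewrite qS /= => /mem_sumset[r [s [rS sS E]]].
have neq u : u \in S -> u != p by apply: contraTneq => ->.
split.
  move: qS; rewrite in_setU1 => /orP[/eqP qp|//].
  by move: E; rewrite qp => /double_inj[rp _]; rewrite -rp rS in pS.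
exists r, s; split=> //.
  apply/eqP=> rs; move: E; rewrite rs => /esym /double_inj[ps _].
  by rewrite ps sS in pS.
split; apply/eqP=> E1.
  move: E; rewrite E1 addrC => /addrI /g_inj ps.
  by rewrite ps sS in pS.
by move: E; rewrite E1 => /addIr /g_inj pr; rewrite pr rS in pS.
Qed.

(** The new pair consists of [s] and [p], in the order given by the sign. If [s] were already
    paired, [p] would be its partner, hence in [S], or [s] would be the midpoint of [p] and that
    partner. *)
Lemma segre_extend S A phi w p s :
    p \notin S -> segre S A phi w -> s \in S -> (0 < #|A|)%N ->
    g p = g s + w \/ g p = g s - w ->
  exists A' phi' w', segre (p |: S) A' phi' w' /\ #|A'| = #|A|.+1.
Proof.
move=> pS seg sS; case: (seg) => /subsetP sA sphi dis gphi.
move=> /card_gt0P[a0 a0A].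
have w0 : w != 0.
  apply/eqP=> w0; have := gphi _ a0A; rewrite w0 addr0 => /g_inj E.
  by have := disjointFr dis a0A; rewrite -{1}E imset_f.
have neq u : u \in S -> u != p by apply: contraTneq => ->.
have aphi a : a \in A -> phi a \in S.
  by move=> aA; apply: (subsetP sphi); apply: imset_f.
have pA : p \notin A by apply: contra pS => /sA.
have pphiA : p \notin phi @: A by apply: contra pS => /(subsetP sphi).
have sAF : s \in A -> g p = g s + w \/ g p = g s - w -> False.
  move=> sA' [E|E].
    by case/eqP: (neq _ (aphi _ sA')); apply: g_inj; rewrite gphi.
  have : g s + g s = g p + g (phi s) by rewrite E gphi // addrACA addNr addr0.
  by case/double_inj=> [ps _]; rewrite ps sS in pS.
have sphiF : s \in phi @: A -> g p = g s + w \/ g p = g s - w -> False.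
  move=> /imsetP[a aA sa] [E|E].
    have : g s + g s = g p + g a.
      by rewrite E sa gphi // -[RHS]addrA [w + g a]addrC.
    by case/double_inj=> [ps _]; rewrite ps sS in pS.
  by case/eqP: (neq _ (sA _ aA)); apply: g_inj; rewrite E sa gphi // addrK.
move=> E.
have sA' : s \notin A by apply/negP=> /sAF /(_ E).
have sphiA : s \notin phi @: A by apply/negP=> /sphiF /(_ E).
have sp := neq _ sS.
pose upd (x y z : T) := if z == x then y else phi z.
have updA x y : x \notin A -> (upd x y) @: (x |: A) = y |: phi @: A.
  move=> xA; rewrite imsetU1 /upd eqxx; congr (_ |: _).
  apply: eq_in_imset => z zA; case: eqP => // zx.
  by rewrite -zx zA in xA.
have disU x y : x \notin A -> y \notin phi @: A -> x \notin phi @: A ->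
  y \notin A ->
    x != y -> [disjoint x |: A & y |: phi @: A].
  move=> xA yphi xphi yA xy; rewrite disjoint_subset; apply/subsetP=> z.
  rewrite in_setU1 inE in_setU1 negb_or => /orP[/eqP->|zA]; first by rewrite xy.
  by rewrite (disjointFr dis zA) andbT; apply: contraNneq yA => <-.
case: E => E.
  exists (s |: A), (upd s p), w; rewrite cardsU1 sA'; split=> //; split.
  - by apply/subsetP=> x /setU1P[->|/sA xS]; rewrite !inE ?sS ?xS ?orbT.
  - by rewrite updA //; apply: setUS.
  - by rewrite updA // disU.
  - move=> x /setU1P[->|xA]; first by rewrite /upd eqxx.
    by rewrite /upd; case: eqP xA => [->|_ xA]; rewrite ?(negPf sA') ?gphi.
exists (p |: A), (upd p s), w; rewrite cardsU1 pA; split=> //; split.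
- by apply: setUS; apply/subsetP.
- rewrite updA //; apply/subsetP=> x /setU1P[->|/(subsetP sphi) xS].
    by rewrite !inE sS orbT.
  by rewrite !inE xS orbT.
- by rewrite updA // disU // eq_sym.
- move=> x /setU1P[->|xA]; first by rewrite /upd eqxx E subrK.
  by rewrite /upd; case: eqP xA => [->|_ xA]; rewrite ?(negPf pA) ?gphi.
Qed.

Lemma segreI S A phi w :
    {in A, forall a, [/\ a \in S, phi a \in S, phi a \notin A
                       & g (phi a) = g a + w]} ->
  segre S A phi w.
Proof.
move=> H; split.
- by apply/subsetP=> a /H[].
- by apply/subsetP=> _ /imsetP[a /H[_ ? _ _] ->].
- rewrite disjoint_sym disjoint_subset.
  by apply/subsetP=> _ /imsetP[a /H[_ _ + _] ->].
- by move=> a /H[].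
Qed.

Lemma segreU1 S A phi w p : segre S A phi w -> segre (p |: S) A phi w.
Proof.
by case=> *; split=> //; apply: subset_trans (subsetUr _ _); eassumption.
Qed.

(** One coincidence [p + q = r + s] is a parallelogram: the translation by [s - q] takes [q] to [s]
    and [r] to [p]. *)
Lemma segre_pair S p :
    p \notin S -> #|(p |: S) :\: indecomposable S p| = 1%N ->
  exists A phi w, segre (p |: S) A phi w /\ #|A| = 2%N.
Proof.
move=> pS card1.
have /card_gt0P[q /decomposableP[//|qS]] :
    (0 < #|(p |: S) :\: indecomposable S p|)%N by rewrite card1.
case=> r [s [rS sS E rs [rq sq]]].
have neq u : u \in S -> p != u by apply: contraTneq => <-.
exists [set q; r], (fun x => if x == q then s else p), (g s - g q).
split; last by rewrite cards2 eq_sym rq.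
apply: segreI => x; rewrite !inE => /orP[] /eqP->.
  rewrite eqxx qS sS !orbT (negPf sq) eq_sym (negPf rs); split=> //.
  by rewrite addrCA subrr addr0.
rewrite (negPf rq) rS orbT eqxx /= !(negPf (neq _ _)) //; split=> //.
by rewrite addrA -E addrK.
Qed.

(** With two pairs, [a], [u], [phi a], [phi u] form a parallelogram that can also be read along
    [u - a]. In that direction [p + a = u + s] makes [s] and [p] a third pair. *)
Lemma segre_square S A phi w p a u s :
    p \notin S -> segre S A phi w -> #|A| = 2%N ->
    a \in A -> u \in A -> u != a -> s \in S -> s \notin A ->
      s \notin phi @: A ->
    g p + g a = g u + g s ->
  exists A' phi' w', segre (p |: S) A' phi' w' /\ #|A'| = #|A|.+1.
Proof.
move=> pS seg cA aA uA ua sS sA sphi E;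
  case: (seg) => /subsetP AS /subsetP phiS dis gphi.
have inj := segre_inj seg.
have neq v : v \in S -> p != v by apply: contraTneq => <-.
have phi_in v : v \in A -> phi v \in phi @: A by apply: imset_f.
have Aphi x y : x \in A -> y \in A -> x != phi y.
  by move=> xA yA; apply/eqP=> xy; have := disjointFr dis xA; rewrite xy phi_in.
have sphi' v : v \in A -> s != phi v.
  by move=> /phi_in; apply: contraTneq => <-.
have sA' v : v \in A -> s != v by apply: contraTneq => <-.
exists [set a; phi a; s],
  (fun x => if x == a then u else if x == phi a then phi u else p), (g u - g a).
split; last first.
  by rewrite cA setUC cardsU1 cards2 !inE negb_or !sphi' ?sA' ?Aphi.
have phiA x y : x \in A -> y \in A -> (phi x == y) = false.
  by move=> xA yA; rewrite eq_sym; apply/negbTE/Aphi.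
have phi_au : (phi u == phi a) = false by rewrite (inj_in_eq inj) ?(negPf ua).
have us : (u == s) = false by rewrite eq_sym (negPf (sA' _ uA)).
have phi_us : (phi u == s) = false by rewrite eq_sym (negPf (sphi' _ uA)).
have F := (eqxx, negPf ua, phi_au, phiA _ _ aA aA, phiA _ _ uA aA,
  (phiA _ _ aA uA, negPf (Aphi _ _ uA aA), negPf (Aphi _ _ aA uA)),
  (negPf (sphi' _ aA), negPf (sA' _ aA), us, phi_us),
  (negPf (neq _ sS), negPf (neq _ (AS _ aA)),
   negPf (neq _ (phiS _ (phi_in _ aA))))).
apply: segreI => x; rewrite !inE => /orP[/orP[]|] /eqP->.
- by rewrite !F !AS // !orbT; split=> //; rewrite addrCA subrr addr0.
- rewrite !F !phiS ?phi_in // !orbT; split=> //.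
  by rewrite !gphi // [RHS]addrC addrA addrNK.
rewrite !F sS orbT; split=> //.
by rewrite addrA [g s + _]addrC -E addrK.
Qed.


Lemma segre_step S A phi w p :
    p \notin S -> segre S A phi w -> #|A| = (defect S).+1 -> (1 < #|A|)%N ->
    #|(p |: S) :\: indecomposable S p| = #|A| ->
  exists A' phi' w', segre (p |: S) A' phi' w' /\ #|A'| = #|A|.+1.
Proof.
move=> pS seg rkS A2 cardD.
set Dec := (p |: S) :\: indecomposable S p in cardD.
pose b := base A phi; pose h := top A phi.
have binj := base_top_inj seg.
(* If [q] and [r] lie in the same column, [p - s = r - q] is [w] or [-w]. *)
have [/existsP[q /existsP[r /existsP[s /and5P[qS rS sS /eqP E]]]]|none] :=
    boolP [exists q, exists r, exists s,
      [&& q \in S, r \in S, s \in S, g p + g q == g r + g s & b q == b r]].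
  move=> /eqP bqr; apply: (segre_extend pS seg sS); first exact: ltnW.
  have tqr : h q != h r.
    apply/eqP=> /(binj _ _ bqr) qr; move: E.
    by rewrite qr addrC => /addrI /g_inj ps; rewrite ps sS in pS.
  have -> : g p = g s + (w *+ h r - w *+ h q).
    have -> : g p = g r + g s - g q by rewrite -E addrK.
    rewrite (segreE seg r) (segreE seg q) -/b -/h -bqr opprD.
    by rewrite -!addrA addrCA [in RHS]addrCA; congr (_ + _); rewrite addrCA;
       congr (_ + _); rewrite addrA subrr add0r.
  by case: (h q) (h r) tqr => [] [] //= _; rewrite ?sub0r ?subr0; [right|left].
have noneP q r s : q \in S -> r \in S -> s \in S -> g p + g q = g r + g s ->
    (b q == b r) = false /\ (b q == b s) = false.
  move=> qS rS sS E; split; apply: contraNF none => bq; apply/existsP; exists q;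
    apply/existsP.
    by exists r; apply/existsP; exists s; rewrite qS rS sS E bq eqxx.
  by exists s; apply/existsP; exists r; rewrite qS rS sS E bq addrC eqxx.
have coord q1 r1 s1 q2 r2 s2 :
    [/\ q1 \in S, r1 \in S & s1 \in S] -> [/\ q2 \in S, r2 \in S & s2 \in S] ->
    g p + g q1 = g r1 + g s1 -> g p + g q2 = g r2 + g s2 ->
    (forall i, (b r1 == i) + (b s1 == i) + (b q2 == i) =
      (b r2 == i) + (b s2 == i) + (b q1 == i))%N /\
    (h r1 + h s1 + h q2 = h r2 + h s2 + h q1)%N.
  move=> [q1S r1S s1S] [q2S r2S s2S] E1 E2.
  by apply: (segre_coord3 seg rkS) => //; rewrite -E1 -E2 addrAC.
have DecP q : q \in Dec -> q \in S /\ exists r s, [/\ r \in S, s \in S,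
    g p + g q = g r + g s, r != s & (r != q) /\ (s != q)].
  exact: decomposableP.
(* Once [p] is eliminated, [b q] must occur among the columns of [r], [s] and [q'], and [noneP]
   excludes [r] and [s]. Hence [Dec] lies in a single column and has at most two elements. *)
have same q q' : q \in Dec -> q' \in Dec -> b q' = b q.
  move=> /DecP[qS [r [s [rS sS E _ _]]]] /DecP[q'S [r' [s' [r'S s'S E' _ _]]]].
  have [H _] := coord _ _ _ _ _ _ (And3 qS rS sS) (And3 q'S r'S s'S) E E'.
  have [qr qs] := noneP _ _ _ qS rS sS E.
  move: (H (b q)); rewrite eqxx ![_ == b q]eq_sym qr qs.
  by case: eqP => // _; rewrite addn1.
have [q1 [q2 [q1D q2D q12 h1 h2]]] : exists q1 q2,
    [/\ q1 \in Dec, q2 \in Dec, q1 != q2, ~~ h q1 & h q2].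
  have : (1 < #|Dec|)%N by rewrite cardD.
  case/card_gt1P=> x [y [xD yD xy]].
  have hxy : h x != h y.
    by apply: contraNneq xy => /(binj _ _ (esym (same _ _ xD yD)))->.
  case hx: (h x) hxy; case hy: (h y) => // _.
    by exists y, x; rewrite hx hy eq_sym.
  by exists x, y; rewrite hx hy.
have [a aA q2E] := topP h2.
have q1E : q1 = a.
  by rewrite -(base_id h1) -/b -(same _ _ q1D q2D) q2E /b (base_phi seg).
have cardA : #|A| = 2%N.
  apply/eqP; rewrite eqn_leq A2 andbT -cardD.
  apply: leq_trans (_ : #|[set a; phi a]| <= 2)%N; last by rewrite cards2;
    case: eqP.
  apply/subset_leq_card/subsetP=> q qD; rewrite !inE -q2E -{1}q1E.
  case hq: (h q).
    apply/orP; right; apply/eqP/binj; first exact: same.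
    by rewrite -/(h q) hq -/(h q2) h2.
  apply/orP; left; apply/eqP/binj; first exact: same.
  by rewrite -/(h q) hq -/(h q1) (negbTE h1).
(* [r] is in [A] because its column has a top entry. Then [a] and [r] exhaust [A], so [s] lies
   outside both rows. *)
have finish r s : r \in S -> s \in S -> g p + g a = g r + g s -> b r != b s ->
    h r = false -> (exists r', h r' /\ b r' = b r) ->
    exists A' phi' w', segre (p |: S) A' phi' w' /\ #|A'| = #|A|.+1.
  move=> rS sS E brs hr [r' [hr' brr']].
  have [qS _] := DecP _ q1D; rewrite q1E in qS.
  have [bar bas] := noneP _ _ _ qS rS sS E.
  have br : b r = r by apply: base_id; rewrite -/(h r) hr.
  have ba : b a = a by apply: (base_A seg).
  have rA : r \in A.
    by have [u uA r'E] := topP hr'; rewrite -br -brr' r'E /b (base_phi seg).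
  rewrite ba br in bar; rewrite ba in bas; rewrite br in brs.
  have bsA : b s \notin A.
    apply/negP=> sA.
    have : (#|[set a; r; b s]| <= #|A|)%N.
      by apply/subset_leq_card/subsetP=> x;
        rewrite !inE => /orP[/orP[]|] /eqP->.
    rewrite cardA setUC cardsU1 cards2 !inE negb_or ![b s == _]eq_sym bas bar.
    by rewrite (negbTE brs).
  apply: (@segre_square S A phi w p a r s) => //.
  - by rewrite eq_sym bar.
  - by apply: contra bsA => sA; rewrite /b (base_A seg).
  - by apply: contra bsA => /imsetP[x xA ->]; rewrite /b (base_phi seg).
have [q1S [r1 [s1 [r1S s1S E1 rs1 _]]]] := DecP _ q1D.
have [q2S [r2 [s2 [r2S s2S E2 rs2 _]]]] := DecP _ q2D.
have [Hb Ht] := coord _ _ _ _ _ _ (And3 q1S r1S s1S) (And3 q2S r2S s2S) E1 E2.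
rewrite q1E in E1.
rewrite h2 (negbTE h1) addn0 in Ht.
have Hb' i : ((b r1 == i) + (b s1 == i) = (b r2 == i) + (b s2 == i))%N.
  by apply/eqP; rewrite -(eqn_add2r (b q1 == i)) -{1}(same _ _ q1D q2D) Hb.
(* If [r1] and [s1] shared a column, so would [r2] and [s2]; each pair would then contain exactly
   one top entry, against [Ht]. *)
have brs1 : b r1 != b s1.
  apply: contraTneq isT => brs.
  have t1 : h r1 != h s1 by apply: contraNneq rs1 => /(binj _ _ brs)->.
  have brs2 : b r2 = b s2.
    have := Hb' (b r1); rewrite -brs eqxx.
    by case: eqP => [->|]; case: eqP => [->|].
  have t2 : h r2 != h s2 by apply: contraNneq rs2 => /(binj _ _ brs2)->.
  by move: Ht t1 t2; do 4 case: (h _).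
have matching : (b r2 = b r1 /\ b s2 = b s1) \/ (b r2 = b s1 /\ b s2 = b r1).
  have := Hb' (b r1); have := Hb' (b s1).
  rewrite !eqxx (negbTE brs1) [b s1 == _]eq_sym (negbTE brs1).
  have [e1|_] := eqVneq (b r2) (b s1); have [e2|_] := eqVneq (b s2) (b s1);
    have [e3|_] := eqVneq (b r2) (b r1);
      have [e4|_] := eqVneq (b s2) (b r1) => // _ _.
  - by case/eqP: brs1; rewrite -e1 -e3.
  - by right.
  - by left.
  - by case/eqP: brs1; rewrite -e2 -e4.
clear Hb Hb'; wlog [m1 m2] : r2 s2 r2S s2S E2 rs2 Ht matching /
    b r2 = b r1 /\ b s2 = b s1.
  move=> W; case: (matching) => [|[m1 m2]]; first exact: W.
  apply: (W s2 r2) => //;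
    [by rewrite E2 addrC|by rewrite eq_sym|by rewrite Ht addnC|by left].
(* [Ht] leaves four cases; in each, one of the two columns has a lower entry among [r1], [s1] and a
   top entry among [r2], [s2]. *)
case hr1: (h r1) Ht; case hr2: (h r2); case hs1: (h s1);
  case hs2: (h s2) => // _.
- by apply: (finish s1 r1) => //; [rewrite E1 addrC|rewrite eq_sym|exists s2].
- by apply: (finish r1 s1) => //; exists r2.
- by apply: (finish r1 s1) => //; exists r2.
- by apply: (finish s1 r1) => //; [rewrite E1 addrC|rewrite eq_sym|exists s2].
Qed.

(** A vector outside the span changes neither the defect nor [A]. The first dependent vector creates
    a parallelogram, and each later one enlarges [A] by one, in step with the defect. *)
Lemma freiman_classification S : freiman_set S ->
  defect S = 0%N \/
  exists A phi w, segre S A phi w /\ #|A| = (defect S).+1.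
Proof.
elim/set_ind1: S => [|S p pS IH] fS; first by left; rewrite /defect cards0.
have [pin|pin] := boolP (g p <= span S)%MS; last first.
  rewrite defectU1_notin //;
    have [|[A [phi [w [seg cA]]]]] := IH (freiman_setU1_notin pS pin fS).
    by left.
  by right; exists A, phi, w; split=> //; apply: segreU1.
have [fS'] := freiman_setU1_in pS pin fS; rewrite defectU1_in // => cardD.
right; have [d0|d0] := eqVneq (defect S) 0%N.
  by rewrite d0; apply: segre_pair => //; rewrite cardD d0.
have [|[A [phi [w [seg cA]]]]] := IH fS'; first by move/eqP;
  rewrite (negbTE d0).
by rewrite -cA; apply: segre_step seg _ _ _; rewrite ?cardD ?cA // ltnS lt0n.
Qed.

(* Each pair a != a' in A gives a coincidence a + phi a' = a' + phi a. *)
Lemma segre_sumset_leq S A phi w : segre S A phi w ->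
  (#|sumset S| + 'C(#|A|, 2) <= 'C(#|S|.+1, 2))%N.
Proof.
have [d] := ubnP #|A|; elim: d S A => // d IH S A; rewrite ltnS => hd seg.
have triv S' : (#|sumset S'| <= 'C(#|S'|.+1, 2))%N.
  elim/set_ind1: S' => [|S' p pS' IHS].
    suff -> : sumset set0 = set0 by rewrite cards0.
    by apply/setP=> c; rewrite inE; apply/imset2P=> -[i j]; rewrite inE.
  have : (#|indecomposable S' p| <= #|p |: S'|)%N.
    by apply/subset_leq_card/subsetP=> x; rewrite inE => /andP[].
  by rewrite card_sumsetU1 cardsU1 pS' add1n (binS #|S'|.+1) bin1; lia.
have [->|[a aA]] := set_0Vmem A; first by rewrite cards0 addn0 triv.
case: (seg) => /subsetP AS /subsetP phiS dis gphi.
have phiaS : phi a \in S by apply/phiS/imset_f.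
have seg' : segre (S :\ phi a) (A :\ a) phi w.
  apply: segreI => x /setD1P[xa xA]; have xphi := imset_f phi xA.
  rewrite !in_setD1 AS // phiS // gphi // (inj_in_eq (segre_inj seg)) // xa.
  rewrite (disjointFl dis xphi) andbF; split=> //; rewrite andbT.
  by apply: contraTneq xA => ->; rewrite (disjointFl dis) ?imset_f.
have := IH _ _ _ seg'; rewrite [#|A|](cardsD1 a) aA add1n.
have := card_sumsetU1 (S :\ phi a) (phi a); rewrite setD1K //.
set I := indecomposable _ _ => cS.
(* Each [x] in [A :\ a] is decomposable with respect to [phi a], as [phi a + x = phi x + a]. *)
suff : (#|I| + #|A :\ a| <= #|S|)%N.
  rewrite [#|S|](cardsD1 (phi a)) phiaS add1n !(binS _.+1) !bin1.
  move: hd; rewrite (cardsD1 a) aA => hd cI /(_ hd).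
  rewrite (binS #|A :\ a|) bin1; lia.
have sub : A :\ a \subset S.
  by apply/subsetP=> x /setD1P[_ /AS].
have sub' : I \subset S :\: (A :\ a).
  apply/subsetP=> x; rewrite inE setD1K // => /andP[xS nd].
  rewrite inE xS andbT; apply: contra nd => /[dup] xA' /setD1P[xa xA].
  apply/mem_sumset; exists (phi x), a; case: seg' => _ /subsetP phiS' _ _.
  rewrite phiS' ?imset_f // !inE AS // andbT !gphi // addrAC; split=> //;
    last by rewrite [g a + g x]addrC addrAC.
  by apply/eqP=> E; have := disjointFr dis aA; rewrite {1}E imset_f.
have := subset_leq_card sub'; have := subset_leq_card sub.
by rewrite (cardsD S) (setIidPr sub); lia.
Qed.

End Sumset.

(** * Toric ideals *)

Lemma det_mx2 (R : comNzRingType) (M : 'M[R]_2) :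
  \det M = M 0 0 * M 1 1 - M 0 1 * M 1 0.
Proof.
rewrite (expand_det_row _ 0) big_ord_recl big_ord1 /cofactor.
rewrite !det_mx11 !mxE /= !expr0 expr1 mul1r mulN1r mulrN.
have -> : lift 0 0 = 1 :> 'I_2 by apply: val_inj.
by have -> : lift (1 : 'I_2) 0 = 0 :> 'I_2 by apply: val_inj.
Qed.

Lemma minors2P (k : fieldType) (t m : nat) (v : 'I_2 * 'I_m -> 'I_t)
    (q : {mpoly k[t]}) :
  reflect (exists i j : 'I_m, (i < j)%N /\
     q = 'X_(v (ord0, i)) * 'X_(v (ord_max, j)) - 'X_(v (ord0,
       j)) * 'X_(v (ord_max, i)))
   (q \in minors2 (\matrix_(i, j) 'X_(v (i, j)))).
Proof.
have detE (g : {ffun 'I_2 -> 'I_m}) :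
    \det (colsub g (\matrix_(i, j) ('X_(v (i, j)) : {mpoly k[t]}))) =
    'X_(v (ord0, g ord0)) * 'X_(v (ord_max, g ord_max))
    - 'X_(v (ord0, g ord_max)) * 'X_(v (ord_max, g ord0)).
  have -> : ord_max = 1 :> 'I_2 by apply: val_inj.
  by rewrite det_mx2 !mxE.
rewrite unfold_in; apply: (iffP existsP) =>
  [[g /andP[lt /eqP->]]|[i [j [lt ->]]]].
  by exists (g ord0), (g ord_max); split=> //; rewrite detE.
exists [ffun x => if x == ord0 then i else j].
have F : (ord_max == ord0 :> 'I_2) = false by [].
by rewrite detE !ffunE F !eqxx lt.
Qed.

Section Toric.
Variables (k : fieldType) (t N : nat) (h : 'I_t -> 'X_{1..N}).
Implicit Types (p q : {mpoly k[t]}) (u v m : 'X_{1..t}).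

Definition toric_weight m : 'X_{1..N} :=
  [multinom (\sum_j h j i * m j)%N | i < N].

Definition toric_vec j : 'rV[rat]_N := \row_i (h j i)%:R.

Definition toric p : {mpoly k[N]} := p \mPo [tuple 'X_[h j] | j < t].

HB.instance Definition _ := GRing.RMorphism.copy toric
  (comp_mpoly [tuple 'X_[h j] : {mpoly k[N]} | j < t]).
HB.instance Definition _ := GRing.Linear.copy toric
  (comp_mpoly [tuple 'X_[h j] : {mpoly k[N]} | j < t]).

Lemma toricX m : toric 'X_[m] = 'X_[toric_weight m].
Proof.
rewrite /toric comp_mpolyX (eq_bigr (fun j => 'X_[h j] ^+ m j)) => [|j _].
  rewrite mprodXnE; congr 'X_[_]; apply/mnmP=> i.
  by rewrite mnm_sumE mnmE; apply: eq_bigr => j _; rewrite mulmnE.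
by rewrite tnth_mktuple.
Qed.

Lemma toricE p : toric p = \sum_(m <- msupp p) p@_m *: 'X_[toric_weight m].
Proof.
rewrite [in LHS](mpolyE p) raddf_sum /=.
by apply: eq_bigr => m _; rewrite linearZ /= toricX.
Qed.

Lemma toric_weightD u v : toric_weight (u + v) = (toric_weight u +
  toric_weight v)%MM.
Proof.
apply/mnmP=> i; rewrite !(mnmE, mnmDE) -big_split.
by apply: eq_bigr => j _; rewrite mnmDE mulnDr.
Qed.

Lemma toric_weightU j : toric_weight U_(j) = h j.
Proof.
apply/mnmP=> i; rewrite mnmE (bigD1 j) //= mnm1E eqxx muln1 big1 ?addn0 // => l.
by rewrite mnm1E eq_sym => /negPf->; rewrite muln0.
Qed.

Lemma toric_weightP u v : toric_weight u = toric_weight v <->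
  \sum_j toric_vec j *+ u j = \sum_j toric_vec j *+ v j.
Proof.
have E (w : 'X_{1..t}) i : (\sum_j toric_vec j *+ w j) 0 i = (toric_weight w
  i)%:R.
  rewrite summxE mnmE natr_sum; apply: eq_bigr => j _.
  by rewrite mulmxnE mxE natrM mulr_natr.
split=> [H|H]; first by apply/rowP=> i; rewrite !E H.
apply/mnmP=> i; apply/eqP; rewrite -(eqr_nat rat) -!E H //.
Qed.

Lemma toric_binomial u v :
  (toric ('X_[u] - 'X_[v]) == 0) = (toric_weight u == toric_weight v).
Proof.
rewrite raddfB /= !toricX subr_eq0; apply/eqP/eqP=> [|->//].
move=> /(congr1 (mcoeff (toric_weight u))); rewrite !mcoeffX eqxx.
by case: eqP => // _ /eqP; rewrite oner_eq0.
Qed.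

(** On each fiber of [toric_weight] the coefficients of [p] add up to 0, so every monomial of [p]
    may be replaced by its difference with one fixed support monomial [rep m] of the same weight. *)
Lemma toric_ker_binomials (G : {pred {mpoly k[t]}}) p :
    (forall u v, toric_weight u = toric_weight v ->
      'X_[u] - 'X_[v] \in ideal_gen G) ->
  toric p = 0 -> p \in ideal_gen G.
Proof.
move=> HG p0.
pose rep m := head m [seq m' <- msupp p | toric_weight m' == toric_weight m].
have repE m : toric_weight (rep m) = toric_weight m.
  rewrite /rep; case E: [seq _ <- _ | _] => [|m' s] //=.
  have : m' \in [seq m' <- msupp p | toric_weight m' == toric_weight m].
    by rewrite E mem_head.
  by rewrite mem_filter => /andP[/eqP].
have rep_eq m m' : m \in msupp p -> toric_weight m = toric_weight m' ->
  rep m = rep m'.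
  move=> mp E; rewrite /rep E.
  have : m \in [seq x <- msupp p | toric_weight x == toric_weight m'].
    by rewrite mem_filter E eqxx.
  by case: [seq x <- _ | _].
have p_rep : \sum_(m <- msupp p) p@_m *: 'X_[rep m] = 0 :> {mpoly k[t]}.
  apply/mpolyP=> m0; rewrite mcoeff0 raddf_sum /=.
  have [/hasP[m1 m1p /eqP m10]|none] :=
    boolP (has (fun m => rep m == m0) (msupp p)).
    have := congr1 (mcoeff (toric_weight m0)) p0.
    rewrite mcoeff0 toricE raddf_sum /= => E; rewrite -[RHS]E.
    apply: eq_big_seq => m mp; rewrite !mcoeffZ !mcoeffX; congr (_ * _%:R).
    congr nat_of_bool; apply/eqP/eqP=> [<-|]; first by rewrite repE.
    by rewrite -m10 repE => /(rep_eq _ _ mp).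
  rewrite big1_seq // => m /= mp; rewrite mcoeffZ mcoeffX.
  by rewrite (negPf (hasPn none m mp)) mulr0.
have -> : p = \sum_(m <- msupp p) (p@_m)%:MP * ('X_[m] - 'X_[rep m]).
  under eq_bigr do rewrite mulrBr.
  rewrite sumrB; under [X in _ = _ - X]eq_bigr do rewrite mul_mpolyC.
  rewrite p_rep subr0 {1}(mpolyE p).
  by apply: eq_bigr => m _; rewrite mul_mpolyC.
apply: ideal_gen_sum => m _.
by apply: ideal_genMl; apply: HG; rewrite repE.
Qed.

Hypothesis h_inj : injective h.

Lemma toric_vec_inj : injective toric_vec.
Proof.
move=> i j E; apply: h_inj; apply/mnmP=> x; apply/eqP; rewrite -(eqr_nat rat).
by have := congr1 (fun M : 'rV_N => M 0 x) E; rewrite !mxE => ->.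
Qed.

Section Swap.
Variables (A : {set 'I_t}) (phi : 'I_t -> 'I_t) (w : 'rV[rat]_N).
Hypothesis seg : segre toric_vec [set: 'I_t] A phi w.
Hypothesis cA : #|A| = (defect toric_vec [set: 'I_t]).+1.

Lemma segre_weight u v : toric_weight u = toric_weight v ->
  [/\ forall i, i \notin A -> i \notin phi @: A -> u i = v i,
      forall a, a \in A -> (u a + u (phi a) = v a + v (phi a))%N
    & (\sum_(a in A) u (phi a) = \sum_(a in A) v (phi a))%N].
Proof.
move/toric_weightP=> E.
have [] := segre_coord toric_vec_inj seg cA (u := u) (v := v).
  by rewrite [LHS](eq_bigl predT) ?E => [|j]; [apply: eq_bigl => j|];
    rewrite inE.
move=> H1 H2; have inj := segre_inj toric_vec_inj seg; split.
- move=> i iA iphi; have := H1 i (in_setT _) iphi.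
  have F (x : 'X_{1..t}) : (\sum_(j in [set: 'I_t] | base A phi j == i) x j =
    x i)%N.
    rewrite (big_pred1 i) // => j; rewrite in_setT /=.
    apply/eqP/eqP=> [ji|->]; last exact: base_id.
    have [/topP[a aA ja]|tj] := boolP (top A phi j);
      last by rewrite -ji base_id.
    by case/negP: iA; rewrite -ji ja (base_phi toric_vec_inj seg).
  by rewrite !F.
- move=> a aA; have tphi := top_phi phi aA.
  have := H1 a (in_setT _) _; rewrite (top_A seg) // => /(_ isT).
  have F (x : 'X_{1..t}) :
      (\sum_(j in [set: 'I_t] | base A phi j == a) x j = x a + x (phi a))%N.
    rewrite (bigD1 a) /=; last by rewrite in_setT (base_A seg) ?eqxx.
    rewrite (big_pred1 (phi a)) // => j; rewrite in_setT /=.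
    apply/andP/eqP=> [[/eqP ba ja]|->].
      have [tj|tj] := boolP (top A phi j);
        last by rewrite -ba base_id ?eqxx in ja.
      apply: (base_top_inj toric_vec_inj seg); last by rewrite tj tphi.
      by rewrite ba (base_phi toric_vec_inj seg).
    rewrite (base_phi toric_vec_inj seg) // eqxx; split=> //.
    by apply: contraTneq tphi => ->; rewrite (top_A seg).
  by rewrite !F.
have F (x : 'X_{1..t}) : (\sum_(j in [set: 'I_t] | top A phi j) x j = \sum_(a
  in A) x (phi a))%N.
  by rewrite -(big_imset _ inj) /=; apply: eq_bigl => j; rewrite in_setT.
by rewrite -!F.
Qed.

(** Induction on the total excess of [u] over [v] in the second row. Row totals agree, so an excess
    at [phi a] comes with a deficit at some [phi b]; column totals agree, so [u b] is positive. A
    minor replaces [phi a], [b] by [a], [phi b] and lowers the excess. *)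
Lemma swap_binomial (G : {pred {mpoly k[t]}}) :
    (forall a b, a \in A -> b \in A ->
       'X_(phi a) * 'X_b - 'X_a * 'X_(phi b) \in ideal_gen G) ->
  forall u v, toric_weight u = toric_weight v ->
    'X_[u] - 'X_[v] \in ideal_gen G.
Proof.
move=> HG u v; have [d] := ubnP (\sum_(a in A) (u (phi a) - v (phi a)))%N.
have inj := segre_inj toric_vec_inj seg; case: (seg) => _ _ dis gphi.
elim: d u => // d IH u; rewrite ltnS => hd E.
have [U1 U2 U3] := segre_weight E.
have [/existsP[a /andP[aA ua]]|none] :=
  boolP [exists a in A, v (phi a) < u (phi a)]%N; last first.
  have le a : a \in A -> (u (phi a) <= v (phi a))%N.
    by move=> aA; rewrite leqNgt; apply: contra none => lt; apply/existsP;
      exists a; rewrite aA.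
  have eq a : a \in A -> u (phi a) = v (phi a).
    move=> aA; apply/eqP; rewrite eqn_leq le //=.
    have : (\sum_(b in A | b != a) u (phi b) <= \sum_(b in A | b != a) v (phi
      b))%N.
      by apply: leq_sum => b /andP[/le].
    by move: U3; rewrite (bigD1 a) //= [RHS](bigD1 a) //=; lia.
  suff -> : u = v by rewrite subrr ideal_gen0.
  apply/mnmP=> i; have [iA|iA] := boolP (i \in A).
    by have := U2 _ iA; rewrite eq //; lia.
  by have [/imsetP[a aA ->]|iphi] := boolP (i \in phi @: A);
    [exact: eq|exact: U1].
have [/existsP[b /andP[bA ub]]|none] :=
  boolP [exists b in A, u (phi b) < v (phi b)]%N; last first.
  have : (\sum_(b in A | b != a) v (phi b) <= \sum_(b in A | b != a) u (phi
    b))%N.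
    apply: leq_sum => b /andP[bA _]; rewrite leqNgt; apply: contra none => lt.
    by apply/existsP; exists b; rewrite bA.
  by move: U3; rewrite (bigD1 a) //= [RHS](bigD1 a) //=; lia.
have ab : a != b by apply: contraTneq ua => ->; rewrite -leqNgt ltnW.
have phi_b : phi a != b.
  by apply: contraTneq bA => <-; rewrite (disjointFl dis) // imset_f.
have le_u : (U_(phi a) + U_(b) <= u)%MM.
  apply/mnm_lepP=> i; rewrite mnmDE !mnm1E.
  have := U2 _ bA; have [<-|_] := eqVneq (phi a) i.
    by rewrite eq_sym (negPf phi_b); lia.
  by have [<-|_] := eqVneq b i; lia.
pose u0 := (u - (U_(phi a) + U_(b)))%MM.
pose u' := (u0 + (U_(a) + U_(phi b)))%MM.
have uE : u = (u0 + (U_(phi a) + U_(b)))%MM by rewrite submK.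
have u'E i : (u' i + (phi a == i) + (b == i) = u i + (a == i) + (phi b == i))%N.
  by rewrite [in RHS]uE !mnmDE !mnm1E; ring.
have wE : toric_weight u = toric_weight u'.
  have hE : toric_weight (U_(phi a) + U_(b)) = toric_weight (U_(a) + U_(phi b)).
    apply/toric_weightP; have S x y : \sum_j toric_vec j *+ (U_(x) + U_(y))%MM
      j =
        toric_vec x + toric_vec y.
      under eq_bigr do rewrite mnmDE mulrnDr.
      have S1 z : \sum_j toric_vec j *+ U_(z)%MM j = toric_vec z.
        rewrite (bigD1 z) //= mnm1E eqxx big1 ?addr0 // => j.
        by rewrite mnm1E eq_sym => /negPf->; rewrite mulr0n.
      by rewrite big_split /= !S1.
    by rewrite !S !gphi // addrAC addrA.
  by rewrite {1}uE (toric_weightD u0) hE -toric_weightD.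
have -> : 'X_[u] - 'X_[v] = ('X_[u] - 'X_[u']) + ('X_[u'] - 'X_[v]) :> {mpoly
  k[t]}.
  by rewrite addrA addrNK.
apply: ideal_genD.
  rewrite {1}uE /u' !mpolyXD -mulrBr; apply: ideal_genMl; exact: HG.
apply: IH; last by rewrite -wE.
have U'phi x : x \in A -> u' (phi x) = (u (phi x) + (b == x) - (a == x))%N.
  move=> xA; have := u'E (phi x); rewrite !(inj_in_eq inj) //.
  have F y : y \in A -> (y == phi x) = false.
    by move=> yA; apply: contraTF yA => /eqP->;
      rewrite (disjointFl dis) // imset_f.
  by rewrite !F // !addn0 => <-; rewrite addnK.
apply: leq_trans hd.
rewrite (bigD1 a) //= [ltnRHS](bigD1 a) //= U'phi // eqxx [b == a]eq_sym
  (negPf ab).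
rewrite -addSn leq_add //; first by move: ua; clear; lia.
apply: leq_sum => x /andP[xA xa]; rewrite U'phi // [a == x]eq_sym (negPf xa).
by have [<-|_] := eqVneq b x; move: ub; clear; lia.
Qed.

End Swap.

Lemma segre_minors (A : {set 'I_t}) phi w :
    segre toric_vec [set: 'I_t] A phi w ->
    #|A| = (defect toric_vec [set: 'I_t]).+1 ->
  exists M : 'M[{mpoly k[t]}]_(2, #|A|), generic_matrix M /\
    forall p, (toric p == 0) = (p \in ideal_gen (minors2 M)).
Proof.
move=> seg cA; have inj := segre_inj toric_vec_inj seg;
  case: (seg) => _ _ dis gphi.
pose v (x : 'I_2 * 'I_#|A|) :=
  if x.1 == ord0 then enum_val x.2 else phi (enum_val x.2).
have v_inj : injective v.
  move=> [i a] [j b]; rewrite /v /=.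
  have sep x y : x \in A -> y \in A -> x <> phi y.
    move=> xA yA xy; have := disjointFr dis xA; rewrite xy.
    by rewrite imset_f.
  case: (eqVneq i ord0) => [->|i0]; case: (eqVneq j ord0) => [->|j0].
  - by move=> /enum_val_inj->.
  - by move=> /sep[]; apply: enum_valP.
  - by move=> /esym /sep[]; apply: enum_valP.
  - move=> /inj E; congr (_, _); last by apply: enum_val_inj; apply: E;
    apply: enum_valP.
    by case: i j i0 j0 {E} => [[|[]]//= ?] [[|[]]//= ?] _ _; apply: val_inj.
exists (\matrix_(i, j) 'X_(v (i, j))); split; first by exists v.
have v0 i : v (ord0, i) = enum_val i by [].
have v1 i : v (ord_max, i) = phi (enum_val i) by [].
move=> p; apply/eqP/idP => [p0|].
  apply: toric_ker_binomials p0; apply: (swap_binomial seg cA) => a b aA bA.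
  rewrite -(enum_rankK_in aA aA) -(enum_rankK_in aA bA).
  move: (enum_rank_in aA a) (enum_rank_in aA b) => i j.
  have [ij|ji|/val_inj ->] := ltngtP i j.
  - rewrite -opprB -mulN1r; apply: ideal_genMl; apply: ideal_gen_mem.
    by apply/minors2P; exists i, j; rewrite ij !v0 !v1 [in RHS]mulrC;
      split=> //; congr (_ - _); rewrite mulrC.
  - apply: ideal_gen_mem; apply/minors2P; exists j, i; split=> //.
    by rewrite !v0 !v1; congr (_ - _); rewrite mulrC.
  - by rewrite mulrC subrr ideal_gen0.
move: p; apply: ideal_gen_ind => [|x y x0 y0|c _ /minors2P[i [j [_ ->]]]].
- exact: raddf0.
- by rewrite raddfD /= x0 y0 addr0.
rewrite rmorphM /=; apply/eqP; rewrite mulf_eq0; apply/orP; right.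
rewrite -!mpolyXD toric_binomial !toric_weightD !toric_weightU !v0 !v1.
apply/eqP/mnmP=> x; rewrite !mnmDE; apply/eqP; rewrite -(eqr_nat rat) !natrD.
have E (a : 'I_t) : (h a x)%:R = toric_vec a 0 x by rewrite mxE.
by rewrite !E !gphi ?enum_valP // !mxE addrCA.
Qed.


End Toric.

(** * From minors back to the Freiman condition *)

(** [c] is a grading for which the minors are homogeneous, that is, a monomial map to a polynomial
    ring in one variable that kills them. *)
Lemma minors_weight (k : fieldType) (t m : nat) (v : 'I_2 * 'I_m -> 'I_t)
    (c : 'I_t -> nat) (u1 u2 : 'X_{1..t}) :
    (forall i j, c (v (ord0, i)) + c (v (ord_max, j)) =
                 c (v (ord0, j)) + c (v (ord_max, i)))%N ->
    'X_[u1] - 'X_[u2] \in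
      ideal_gen (minors2 (\matrix_(i, j) ('X_(v (i, j)) : {mpoly k[t]}))) ->
  (\sum_j c j * u1 j = \sum_j c j * u2 j)%N.
Proof.
move=> cE mem.
pose h j : 'X_{1..1} := [multinom c j | _ < 1].
suff : toric h ('X_[u1] - 'X_[u2] : {mpoly k[t]}) == 0.
  rewrite toric_binomial => /eqP/mnmP/(_ ord0); rewrite !mnmE.
  by under eq_bigr do rewrite mnmE; under [RHS]eq_bigr do rewrite mnmE.
apply/eqP; move: (_ - _) mem;
  apply: ideal_gen_ind => [|x y x0 y0|a _ /minors2P[i [j [_ ->]]]].
- exact: raddf0.
- by rewrite raddfD /= x0 y0 addr0.
rewrite rmorphM /=; apply/eqP; rewrite mulf_eq0; apply/orP; right.
rewrite -!mpolyXD toric_binomial !toric_weightD !toric_weightU.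
by apply/eqP/mnmP=> x; rewrite !(mnmDE, mnmE) cE.
Qed.

Section Generic.
Variables (k : fieldType) (t N : nat) (h : 'I_t -> 'X_{1..N}).
Hypothesis h_inj : injective h.
Local Notation toric_vec := (toric_vec h).
Local Notation toric_weight := (toric_weight h).
Local Notation toric_vec_inj := (toric_vec_inj h_inj).

(** The minors lie in the kernel, so the rows are translates and [segre_sumset_leq] applies. Nothing
    else does, so gradings respecting the minors detect independence and bound the defect by
    [m - 1]. Together with [freiman_leq] this forces equality. *)
Lemma minors_freiman m (M : 'M[{mpoly k[t]}]_(2, m)) :
    (forall j i, (h j i <= 1)%N) -> (2 <= m)%N -> generic_matrix M ->
    (forall p, (toric h p == 0) = (p \in ideal_gen (minors2 M))) ->
  freiman_set toric_vec [set: 'I_t].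
Proof.
move=> h01 m2 [v v_inj ->] ker.
have g01 i x : (toric_vec i 0 x == 0) || (toric_vec i 0 x == 1).
  by rewrite mxE; have := h01 i x; case: (h i x) => [|[|]] //=;
    rewrite ?eqxx ?orbT.
pose A := [set v (ord0, i) | i : 'I_m].
pose phi x := if [pick i | v (ord0, i) == x] is Some i then v (ord_max,
  i) else x.
have phiE i : phi (v (ord0, i)) = v (ord_max, i).
  rewrite /phi; case: pickP => [j /eqP/v_inj[->] //|/(_ i)].
  by rewrite eqxx.
have i0 : 'I_m by exact: (Ordinal m2).
have hE i j : toric_weight (U_(v (ord0, i)) + U_(v (ord_max, j))) =
              toric_weight (U_(v (ord0, j)) + U_(v (ord_max, i))).
  have lt_case (i' j' : 'I_m) : (i' < j')%N ->
      toric_weight (U_(v (ord0, i')) + U_(v (ord_max, j'))) =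
              toric_weight (U_(v (ord0, j')) + U_(v (ord_max, i'))).
    move=> lt; apply/eqP; rewrite -(toric_binomial k) ker !mpolyXD.
    by apply: ideal_gen_mem; apply/minors2P; exists i', j'.
  by have [/lt_case|/lt_case|/val_inj->] := ltngtP i j.
pose w := toric_vec (v (ord_max, i0)) - toric_vec (v (ord0, i0)).
have seg : segre toric_vec [set: 'I_t] A phi w.
  apply: segreI => _ /imsetP[i _ ->]; rewrite !inE; split=> //.
    by rewrite phiE; apply/imsetP=> -[j _ /v_inj[]].
  rewrite phiE /w; apply/rowP=> x; rewrite !mxE.
  have := congr1 (fun y : 'X_{1..N} => (y x)%:R : rat) (hE i i0).
  rewrite !toric_weightD !toric_weightU !mnmDE !natrD => E.
  by rewrite addrA E addrAC subrr add0r.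
have cA : #|A| = m by rewrite card_imset ?card_ord // => i j /v_inj[].
have inj := segre_inj (toric_vec_inj) seg.
(* The expected basis: the first row, the variables outside the matrix, and one entry of the second
   row standing for [w]. *)
pose D := v (ord_max, i0) |: ~: (phi @: A).
have cD : (#|D| + m = t.+1)%N.
  rewrite cardsU1 !inE negbK -phiE imset_f ?imset_f //= add1n addSn.
  by rewrite -[X in (_ + X).+1]cA -(card_in_imset inj) addnC cardsC card_ord.
have rkD : rk toric_vec D = #|D|.
  apply: rk_of_nat_free => u1 u2 off E.
  have mem : 'X_[[multinom u1 i | i < t]] - 'X_[[multinom u2 i | i < t]] \in
      ideal_gen (minors2 (\matrix_(i, j) ('X_(v (i, j)) : {mpoly k[t]}))).
    rewrite -ker toric_binomial; apply/eqP/toric_weightP.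
    under eq_bigr do rewrite mnmE; rewrite E.
    by apply: eq_bigr => i _; rewrite mnmE.
  have top1 i : top A phi (v (ord_max, i)) by rewrite -phiE; apply: top_phi;
    apply: imset_f.
  have top0 i : top A phi (v (ord0, i)) = false by apply: (top_A seg);
    apply: imset_f.
  have base0 i : base A phi (v (ord0, i)) = v (ord0, i).
    by apply: (base_A seg); apply: imset_f.
  have base1 i : base A phi (v (ord_max, i)) = v (ord0, i).
    by rewrite -phiE (base_phi toric_vec_inj seg) ?imset_f.
  have topE x : top A phi x -> x != v (ord_max, i0) -> u1 x = u2 x.
    move=> tx x0; apply: off; rewrite !inE negb_or x0 negbK; exact: tx.
  (* [v (ord_max, i0)] is the only top element of [D], so the grading by [top] isolates it; the
     gradings [base == x] then isolate the others. *)
  have u10 : u1 (v (ord_max, i0)) = u2 (v (ord_max, i0)).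
    have cE (i j : 'I_m) : (top A phi (v (ord0, i)) + top A phi (v (ord_max,
      j)) =
        top A phi (v (ord0, j)) + top A phi (v (ord_max, i)))%N.
      by rewrite !top0 !top1.
    have := minors_weight (c := fun x => top A phi x) cE mem.
    rewrite (bigD1 (v (ord_max, i0))) //= [RHS](bigD1 (v (ord_max,
      i0))) //= !top1.
    rewrite !mnmE !mul1n (eq_bigr (fun x => top A phi x * u2 x)%N) => [|x xi].
      under [X in _ = (_ + X)%N]eq_bigr do rewrite mnmE.
      by move/eqP; rewrite eqn_add2r => /eqP.
    by rewrite mnmE; case tx: (top A phi x); rewrite // topE.
  move=> x; have [xD|/off//] := boolP (x \in D).
  have [-> //|xi] := eqVneq x (v (ord_max, i0)).
  have tx : ~~ top A phi x by move: xD; rewrite !inE (negPf xi).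
  have cE (i j : 'I_m) : ((base A phi (v (ord0,
    i)) == x) + (base A phi (v (ord_max, j)) == x) =
        (base A phi (v (ord0, j)) == x) + (base A phi (v (ord_max, i)) == x))%N.
    by rewrite !base0 !base1 addnC.
  have := minors_weight (c := fun y => base A phi y == x) cE mem.
  rewrite (bigD1 x) //= [RHS](bigD1 x) //= !mnmE base_id // eqxx !mul1n.
  rewrite (eq_bigr (fun y => (base A phi y == x) * u2 y)%N) => [|y yx].
    under [X in _ = (_ + X)%N]eq_bigr do rewrite mnmE.
    by move/eqP; rewrite eqn_add2r => /eqP.
  rewrite mnmE; case: eqP => // yE; congr (_ * _)%N.
  have ty : top A phi y by apply: contraR yx => /base_id; rewrite yE => ->.
  by have [->//|] := eqVneq y (v (ord_max, i0)); exact: topE.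
have le1 : (rk toric_vec D <= rk toric_vec [set: 'I_t])%N.
  by apply/mxrankS/spanS/subsetP=> x; rewrite inE.
have := freiman_leq toric_vec_inj g01 [set: 'I_t].
have := segre_sumset_leq toric_vec_inj seg;
  have := card_defect toric_vec [set: 'I_t].
rewrite /freiman_set cA cardsT card_ord; rewrite rkD in le1 => cd.
have dm : (defect toric_vec [set: 'I_t] < m)%N by lia.
have := leq_bin2l 2 dm; lia.
Qed.


Lemma freiman_toric : (forall j i, (h j i <= 1)%N) ->
  freiman_set toric_vec [set: 'I_t] <->
  (forall p : {mpoly k[t]}, (toric h p == 0) = (p == 0)) \/
  exists m, (2 <= m)%N /\ exists M : 'M[{mpoly k[t]}]_(2, m),
    generic_matrix M /\ forall p,
      (toric h p == 0) = (p \in ideal_gen (minors2 M)).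
Proof.
move=> h01; split=> [fS|[ker0|[m [m2 [M [gM ker]]]]]];
  last exact: minors_freiman ker.
- have g01 i x : (toric_vec i 0 x == 0) || (toric_vec i 0 x == 1).
    by rewrite mxE; have := h01 i x; case: (h i x) => [|[|]] //=;
      rewrite ?eqxx ?orbT.
  have [d0|d0] := eqVneq (defect toric_vec [set: 'I_t]) 0%N.
    left=> p; apply/eqP/eqP=> [p0|->]; last exact: raddf0.
    have rkT : rk toric_vec [set: 'I_t] = #|[set: 'I_t]|.
      by rewrite -[RHS](card_defect toric_vec) d0 addn0.
    have : p \in ideal_gen (pred0 : {pred {mpoly k[t]}}).
      apply: toric_ker_binomials p0 => u v /toric_weightP E.
      suff -> : u = v by rewrite subrr ideal_gen0.
      apply/mnmP=> i; apply/eqP; rewrite -(eqr_nat rat) -subr_eq0; apply/eqP.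
      apply: (rk_full_free (c := fun i => (u i)%:R - (v i)%:R) rkT) => //.
      rewrite (eq_bigl predT) => [|j]; last by rewrite inE.
      under eq_bigr do rewrite scalerBl !scaler_nat.
      by rewrite sumrB E subrr.
    by move: p {p0}; apply: ideal_gen_ind => // x y -> ->; rewrite addr0.
  right; have [|[A [phi [w [seg cA]]]]] :=
    freiman_classification toric_vec_inj g01 fS.
    by move/eqP; rewrite (negPf d0).
  exists #|A|; split; first by rewrite cA ltnS lt0n.
  exact: segre_minors seg cA.
have rkT : rk toric_vec [set: 'I_t] = #|[set: 'I_t]|.
  apply: rk_of_nat_free => u v _ E.
  pose u' := [multinom u i | i < t]; pose v' := [multinom v i | i < t].
  have : ('X_[u'] - 'X_[v'] : {mpoly k[t]}) == 0.
    rewrite -ker0 toric_binomial; apply/eqP/toric_weightP.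
    under eq_bigr do rewrite mnmE; rewrite E.
    by apply: eq_bigr => i _; rewrite mnmE.
  rewrite subr_eq0 => /eqP/(congr1 (mcoeff u')); rewrite !mcoeffX eqxx.
  case: eqP => [uv _ i|_ /eqP]; last by rewrite oner_eq0.
  by have := congr1 (fun m : 'X_{1..t} => m i) uv; rewrite !mnmE.
(* With empty [A], [segre_sumset_leq] is the trivial bound by the number of unordered pairs with
   repetition. *)
have seg : segre toric_vec [set: 'I_t] set0 id 0.
  by apply: segreI => x; rewrite inE.
have g01 i x : (toric_vec i 0 x == 0) || (toric_vec i 0 x == 1).
  by rewrite mxE; have := h01 i x; case: (h i x) => [|[|]] //=;
    rewrite ?eqxx ?orbT.
have := freiman_leq toric_vec_inj g01 [set: 'I_t].
have := segre_sumset_leq toric_vec_inj seg;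
  rewrite cards0 /freiman_set /defect rkT subnn.
rewrite (@bin_small 0) // (@bin_small 1) // !addn0 => le1 le2.
by apply/eqP; rewrite eqn_leq le1.
Qed.

End Generic.

(** * The fiber cone as a toric ring *)

Section FiberClass.
Variables (k : fieldType) (n : nat) (I : {pred {mpoly k[n]}}).

Lemma fiber_classB : additive (@fiber_class k n I).
Proof. by move=> p q; rewrite /fiber_class rmorphB. Qed.

Lemma fiber_classM : multiplicative (@fiber_class k n I).
Proof. by split=> [p q|]; rewrite /fiber_class ?rmorphM ?rmorph1. Qed.

HB.instance Definition _ := GRing.isAdditive.Build _ _ _ fiber_classB.
HB.instance Definition _ := GRing.isMultiplicative.Build _ _ _ fiber_classM.

Lemma fiber_class_eq0 (r : rees I) :
  fiber_class r = 0 <-> forall i,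
    (rees_val r)`_i \in idealM (@max_ideal k n) (idealX I i).
Proof.
rewrite /fiber_class -(rmorph0 (\pi_({ideal_quot (fiber_ideal I)}))).
split=> [/eqP|H].
  rewrite -Quotient.idealrBE subr0. by move/asboolP.
apply/eqP; rewrite -Quotient.idealrBE subr0; exact/asboolP.
Qed.

Lemma fiber_class_surj (x : fiber_cone I) : exists r, fiber_class r = x.
Proof. by exists (repr x); rewrite /fiber_class reprK. Qed.

Lemma rees_constB : additive (@rees_const _ I).
Proof. by move=> a b; apply: val_inj; rewrite /= polyCB. Qed.

Lemma rees_constM : multiplicative (@rees_const _ I).
Proof. by split=> [a b|]; apply: val_inj; rewrite /= ?polyCM. Qed.

HB.instance Definition _ := GRing.isAdditive.Build _ _ _ rees_constB.
HB.instance Definition _ := GRing.isMultiplicative.Build _ _ _ rees_constM.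

Lemma rees_valB : additive (@rees_val _ I).
Proof. exact: (raddfB val). Qed.

Lemma rees_valM : multiplicative (@rees_val _ I).
Proof. by split; [exact: (rmorphM val)|exact: (rmorph1 val)]. Qed.

HB.instance Definition _ := GRing.isAdditive.Build _ _ _ rees_valB.
HB.instance Definition _ := GRing.isMultiplicative.Build _ _ _ rees_valM.

End FiberClass.

Lemma max_idealP (k : fieldType) (n : nat) (p : {mpoly k[n]}) :
  p@_0%MM = 0 -> p \in @max_ideal k n.
Proof.
move=> p0; rewrite [p]mpolyE big_seq; apply: ideal_gen_sum => m mp.
have [/forallP m0|] := boolP [forall i, m i == 0%N].
  have -> : m = 0%MM by apply/mnmP=> i; rewrite mnm0E; apply/eqP.
  by rewrite p0 scale0r ideal_gen0.
rewrite negb_forall => /existsP[i mi].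
have -> : m = (m - U_(i) + U_(i))%MM.
  rewrite submK //; apply/mnm_lepP=> j; rewrite mnm1E.
  by case: eqP => // <-; rewrite lt0n.
rewrite mpolyXD scalerAl; apply: ideal_genMl; apply: ideal_gen_mem.
exact: codom_f.
Qed.

Section FiberMap.
Variables (k : fieldType) (n t : nat) (f : 'I_t -> 'X_{1..n}).
Local Notation I := (monomial_ideal k f).
Local Notation M := (@max_ideal k n).

Definition fiber_const (c : k) : fiber_cone I :=
  fiber_class (rees_const I c%:MP).

Lemma fiber_constB : additive fiber_const.
Proof. by move=> a b; rewrite /fiber_const !raddfB. Qed.

Lemma fiber_constM : multiplicative fiber_const.
Proof.
by split=> [a b|]; rewrite /fiber_const ?mpolyCM ?mpolyC1 ?rmorphM ?rmorph1.
Qed.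

HB.instance Definition _ := GRing.isAdditive.Build _ _ _ fiber_constB.
HB.instance Definition _ := GRing.isMultiplicative.Build _ _ _ fiber_constM.

Definition fiber_gen j : fiber_cone I :=
  fiber_class (rees_deg1 (monomial_ideal_gen k f j)).

Lemma fiber_mapE : @fiber_map k n t f =1 mmap fiber_const fiber_gen.
Proof. by []. Qed.

Lemma fiber_mapB : additive (@fiber_map k n t f).
Proof. exact: (mmap_is_additive fiber_gen fiber_const). Qed.

Lemma fiber_mapM : multiplicative (@fiber_map k n t f).
Proof. exact: (mmap_is_multiplicative fiber_gen fiber_const). Qed.

HB.instance Definition _ := GRing.isAdditive.Build _ _ _ fiber_mapB.
HB.instance Definition _ := GRing.isMultiplicative.Build _ _ _ fiber_mapM.

(** An explicit representative of [fiber_map p]: vanishing in the fiber cone is a condition on the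
    coefficients of a representative in the Rees algebra. *)
Definition rees_lift (p : {mpoly k[t]}) : rees I :=
  \sum_(m <- msupp p) rees_const I (p@_m)%:MP *
    \prod_j rees_deg1 (monomial_ideal_gen k f j) ^+ m j.

Lemma fiber_map_lift p : @fiber_map k n t f p = fiber_class (rees_lift p).
Proof.
rewrite /rees_lift raddf_sum /=; apply: eq_bigr => m _.
rewrite rmorphM /=; congr (_ * _).
by rewrite rmorph_prod /=; apply: eq_bigr => j _; rewrite rmorphXn.
Qed.

Lemma rees_lift_coef p i :
  (rees_val (rees_lift p))`_i =
  \sum_(m <- msupp p | mdeg m == i) p@_m *: 'X_[toric_weight f m].
Proof.
have -> : rees_val (rees_lift p) =
    \sum_(m <- msupp p) (p@_m *: 'X_[toric_weight f m]) *: 'X^(mdeg m).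
  rewrite /rees_lift raddf_sum /=; apply: eq_bigr => m _.
  rewrite rmorph_prod.
  rewrite (eq_bigr (fun j => 'X_[f j] ^+ m j *: 'X^(m j))) => [|j _];
    last first.
    by rewrite rmorphXn /= exprZn.
  rewrite scaler_prod mprodXnE -expr_sum -mdegE mul_polyC scalerA.
  congr (_ *: _); rewrite mul_mpolyC; congr (_ *: 'X_[_]); apply/mnmP=> x.
  by rewrite mnm_sumE mnmE; apply: eq_bigr => j _; rewrite mulmnE.
rewrite coef_sum [RHS]big_mkcond /=; apply: eq_bigr => m _.
rewrite coefZ coefXn eq_sym; case: eqP => _; by rewrite ?mulr1 ?mulr0.
Qed.

(* Stated for the underlying polynomial P, so that no proof of membership in the
   Rees algebra has to be carried along. *)
Definition in_fiber_image (P : {poly {mpoly k[n]}}) :=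
  exists2 r : rees I, rees_val r = P & exists p,
    @fiber_map k n t f p = fiber_class r.

Lemma in_fiber_imageD P Q :
  in_fiber_image P -> in_fiber_image Q -> in_fiber_image (P + Q).
Proof.
move=> [r <- [p pr]] [s <- [q qs]]; exists (r + s); first exact: raddfD.
by exists (p + q); rewrite !raddfD /= pr qs.
Qed.

Lemma in_fiber_imageM P Q :
  in_fiber_image P -> in_fiber_image Q -> in_fiber_image (P * Q).
Proof.
move=> [r <- [p pr]] [s <- [q qs]]; exists (r * s); first exact: rmorphM.
by exists (p * q); rewrite !rmorphM /= pr qs.
Qed.

Lemma in_fiber_image0 : in_fiber_image 0.
Proof. by exists 0; [exact: raddf0|exists 0; rewrite !raddf0]. Qed.

(** Modulo the maximal ideal, [a] equals its constant coefficient. *)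
Lemma in_fiber_imageC a : in_fiber_image a%:P.
Proof.
exists (rees_const I a) => //; exists (a@_0%MM)%:MP.
rewrite fiber_mapE mmapC; apply/eqP; rewrite eq_sym -subr_eq0.
rewrite /fiber_const -!raddfB /=; apply/eqP/fiber_class_eq0 => i /=.
rewrite coefC; case: eqP => [->|_]; last exact: ideal_gen0.
rewrite -[_ - _]mulr1; apply: idealM_mem => //; apply: max_idealP.
by rewrite mcoeffB mcoeffC eqxx mulr1 subrr.
Qed.

Lemma in_fiber_image_deg1 x : x \in I -> in_fiber_image (x *: 'X).
Proof.
move: x; apply: ideal_gen_ind => [|x y|a _ /codomP[j ->]].
- by rewrite scale0r; apply: in_fiber_image0.
- by rewrite scalerDl; apply: in_fiber_imageD.
rewrite -scalerA -mul_polyC; apply: in_fiber_imageM;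
  first exact: in_fiber_imageC.
exists (rees_deg1 (monomial_ideal_gen k f j)) => //.
by exists 'X_j; rewrite fiber_mapE mmapX mmap1U.
Qed.

Lemma in_fiber_imageX i x : x \in idealX I i -> in_fiber_image (x *: 'X^i).
Proof.
elim: i x => [|i IH] x.
  by move=> _; rewrite expr0 alg_polyC; apply: in_fiber_imageC.
move: x; apply: ideal_gen_ind => [|x y|a _ /asboolP[x Ix [y Iy ->]]].
- by rewrite scale0r; apply: in_fiber_image0.
- by rewrite scalerDl; apply: in_fiber_imageD.
have -> : (a * (x * y)) *: 'X^(i.+1) = a%:P * ((x *: 'X) * (y *: 'X^i)) :>
  {poly {mpoly k[n]}}.
  by rewrite -!mul_polyC !polyCM exprS; ring.
apply: in_fiber_imageM; first exact: in_fiber_imageC.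
by apply: in_fiber_imageM; [exact: in_fiber_image_deg1|exact: IH].
Qed.

Lemma fiber_map_surj (x : fiber_cone I) : exists p, @fiber_map k n t f p = x.
Proof.
have [r <-] := fiber_class_surj x.
have [s /val_inj -> //] : in_fiber_image (rees_val r).
rewrite -[rees_val r]coefK poly_def.
apply: (big_ind in_fiber_image) => [||i _]; first exact: in_fiber_image0.
  exact: in_fiber_imageD.
by apply: in_fiber_imageX; have /asboolP := valP r.
Qed.

End FiberMap.

(** * Weighted degrees *)

Section Weight.
Variables (k : fieldType) (n : nat) (a : 'I_n -> nat).
Implicit Types (m : 'X_{1..n}) (p q : {mpoly k[n]}).

Definition wdeg m := (\sum_i a i * m i)%N.

Lemma wdegD m m' : wdeg (m + m') = (wdeg m + wdeg m')%N.
Proof.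
by rewrite /wdeg -big_split; apply: eq_bigr => i _; rewrite mnmDE mulnDr.
Qed.

(** A filtration rather than a homogeneity condition, as it has to survive multiplication by
    arbitrary polynomials. *)
Definition wdeg_ge d p := forall m, p@_m != 0 -> (d <= wdeg m)%N.

Lemma wdeg_ge0 d : wdeg_ge d 0.
Proof. by move=> m; rewrite mcoeff0 eqxx. Qed.

Lemma wdeg_geD d p q : wdeg_ge d p -> wdeg_ge d q -> wdeg_ge d (p + q).
Proof.
move=> Hp Hq m; rewrite mcoeffD => nz.
have [p0|/Hp//] := eqVneq (p@_m) 0.
by apply: Hq; rewrite p0 add0r in nz.
Qed.

Lemma wdeg_geM d e p q : wdeg_ge d p -> wdeg_ge e q ->
  wdeg_ge (d + e)%N (p * q).
Proof.
move=> Hp Hq m; rewrite -mcoeff_msupp =>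
  /msuppM_le /allpairsP[[m1 m2] /= [m1p m2q ->]].
by rewrite wdegD leq_add ?Hp ?Hq // -mcoeff_msupp.
Qed.

Lemma wdeg_geX d m : (d <= wdeg m)%N -> wdeg_ge d 'X_[m].
Proof.
by move=> dm m'; rewrite mcoeffX; case: (m =P m') => [<-|_]; rewrite ?eqxx.
Qed.

Lemma wdeg_ge_ideal_gen d (S : {pred {mpoly k[n]}}) :
  (forall x, x \in S -> wdeg_ge d x) -> forall x, x \in ideal_gen S ->
    wdeg_ge d x.
Proof.
move=> HS; apply: ideal_gen_ind => [|x y|b x /HS xS]; first exact: wdeg_ge0.
  exact: wdeg_geD.
by rewrite -[d]add0n; apply: wdeg_geM.
Qed.

Lemma wdeg_ge_idealM d e (I J : {pred {mpoly k[n]}}) :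
    (forall x, x \in I -> wdeg_ge d x) -> (forall x, x \in J -> wdeg_ge e x) ->
  forall x, x \in idealM I J -> wdeg_ge (d + e) x.
Proof.
move=> HI HJ; apply: wdeg_ge_ideal_gen => _ /asboolP[x xI [y yJ ->]].
by apply: wdeg_geM; auto.
Qed.

Lemma wdeg_ge_idealX d (I : {pred {mpoly k[n]}}) i :
  (forall x, x \in I -> wdeg_ge d x) -> forall x, x \in idealX I i ->
    wdeg_ge (i * d) x.
Proof.
move=> HI; elim: i => [|i IH]; first by move=> x _ m _.
by rewrite mulSn; apply: wdeg_ge_idealM.
Qed.

Hypothesis a_gt0 : forall i, (0 < a i)%N.

Lemma wdeg_eq0 m : wdeg m = 0%N -> m = 0%MM.
Proof.
move/eqP; rewrite sum_nat_eq0 => /forallP H; apply/mnmP=> i; apply/eqP.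
by have := H i; rewrite muln_eq0 mnm0E -[a i == _]negbK -lt0n a_gt0.
Qed.

Lemma wdeg_ge_max_ideal x : x \in @max_ideal k n -> wdeg_ge 1 x.
Proof.
move: x; apply: wdeg_ge_ideal_gen => _ /codomP[i ->]; apply: wdeg_geX.
by rewrite /wdeg (bigD1 i) //= mnm1E eqxx muln1 addn_gt0 a_gt0.
Qed.

End Weight.

Section Homogenize.
Variable n : nat.

(** The entry [i] is appended in last position. Equal to 1 on each generator, it counts factors and
    so records the power of the ideal to which a product belongs. *)
Definition mext (m : 'X_{1..n}) (i : nat) : 'X_{1..n.+1} :=
  [multinom if unlift ord_max x is Some y then m y else i | x < n.+1].

Lemma mext_max m i : mext m i ord_max = i.
Proof. by rewrite mnmE unlift_none. Qed.

Lemma mext_lift m i y : mext m i (lift ord_max y) = m y.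
Proof. by rewrite mnmE liftK. Qed.

Lemma mext_inj m m' i i' : mext m i = mext m' i' -> m = m' /\ i = i'.
Proof.
move=> E; split; last by rewrite -(mext_max m i) E mext_max.
by apply/mnmP=> y; rewrite -(mext_lift m i) E mext_lift.
Qed.

Lemma toric_weight_mext t (f : 'I_t -> 'X_{1..n}) u :
  toric_weight (fun j => mext (f j) 1) u = mext (toric_weight f u) (mdeg u).
Proof.
apply/mnmP=> x; rewrite mnmE; have [y ->|->] := unliftP ord_max x.
  by rewrite mext_lift mnmE; apply: eq_bigr => j _; rewrite mext_lift.
rewrite mext_max mdegE; apply: eq_bigr => j _.
by rewrite mext_max mul1n.
Qed.

End Homogenize.

Section FiberKernel.
Variables (k : fieldType) (n t : nat) (f : 'I_t -> 'X_{1..n}).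

Lemma quasi_equigenerated_wdeg : quasi_equigenerated f ->
  exists2 a, (forall i, (0 < a i)%N) & exists D, forall j, wdeg a (f j) = D.
Proof.
move=> [a [a_gt0 H]]; exists a => //; have [t0|t_gt0] := posnP t.
  by exists 0%N => j; have := ltn_ord j; rewrite [X in (_ < X)%N]t0.
by exists (wdeg a (f (Ordinal t_gt0))) => j; apply: H.
Qed.

Lemma wdeg_toric_weight a D u : (forall j, wdeg a (f j) = D) ->
  wdeg a (toric_weight f u) = (mdeg u * D)%N.
Proof.
move=> H; rewrite /wdeg mdegE big_distrl /=.
under eq_bigr do rewrite mnmE big_distrr /=.
rewrite exchange_big /=; apply: eq_bigr => j _.
rewrite -(H j) big_distrr /=; apply: eq_bigr => i _.
by rewrite mulnA mulnC.
Qed.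

Lemma wdeg_ge_monomial_ideal a D : (forall j, wdeg a (f j) = D) ->
  forall x, x \in monomial_ideal k f -> wdeg_ge a D x.
Proof.
by move=> H; apply: wdeg_ge_ideal_gen => _ /codomP[j ->]; apply: wdeg_geX;
  rewrite H.
Qed.

(** The coefficient of degree [i] of the lift combines monomials of weight exactly [i * D], while
    those occurring in [m I^i] have weight at least [i * D + 1]: it lies in [m I^i] only if it is 0.
    The last coordinate of [mext] separates the degrees. *)
Lemma fiber_map_eq0 (p : {mpoly k[t]}) : quasi_equigenerated f ->
  (@fiber_map k n t f p == 0) = (toric (fun j => mext (f j) 1) p == 0).
Proof.
move=> /quasi_equigenerated_wdeg[a a_gt0 [D fD]].
rewrite fiber_map_lift; apply/eqP/eqP => [/fiber_class_eq0 H|p0].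
  apply/mpolyP=> m'; rewrite mcoeff0 toricE raddf_sum /=.
  under eq_bigr do rewrite mcoeffZ mcoeffX toric_weight_mext.
  pose i := m' ord_max; pose m0 := [multinom m' (lift ord_max y) | y < n].
  have m'E : m' = mext m0 i.
    apply/mnmP=> x; have [y ->|->] := unliftP ord_max x;
      last by rewrite mext_max.
    by rewrite mext_lift mnmE.
  have extE m : (mext (toric_weight f m) (mdeg m) == m') =
      (mdeg m == i) && (toric_weight f m == m0).
    by rewrite m'E; apply/eqP/andP=> [/mext_inj[-> ->]|[/eqP-> /eqP->]].
  have := H i; rewrite rees_lift_coef => Hi.
  have : (\sum_(m <- msupp p | mdeg m == i) p@_m *: 'X_[toric_weight f m])@_m0
    = 0.
    apply/eqP/negPn/negP => nz.
    have lt : (1 + i * D <= wdeg a m0)%N.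
      apply: (wdeg_ge_idealM _ _ Hi) nz; first exact: wdeg_ge_max_ideal.
      by apply: wdeg_ge_idealX; apply: wdeg_ge_monomial_ideal.
    case/negP: nz; rewrite raddf_sum /= big1 // => m /eqP mi.
    rewrite mcoeffZ mcoeffX; case: eqP => [m0E|]; last by rewrite mulr0.
    by move: lt; rewrite -m0E (wdeg_toric_weight _ fD) mi ltnn.
  rewrite raddf_sum big_mkcond /= => E0; rewrite -[RHS]E0;
    apply: eq_bigr => m _.
  by rewrite extE mcoeffZ mcoeffX; case: (_ == i); rewrite ?mulr0.
apply/fiber_class_eq0 => i; rewrite rees_lift_coef.
suff -> : \sum_(m <- msupp p | mdeg m == i) p@_m *: 'X_[toric_weight f m] = 0
  :> {mpoly k[n]}.
  exact: ideal_gen0.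
apply/mpolyP=> m0; rewrite mcoeff0 raddf_sum big_mkcond /=.
have := congr1 (mcoeff (mext m0 i)) p0;
  rewrite mcoeff0 toricE raddf_sum /= => E.
rewrite -[RHS]E; apply: eq_bigr => m _.
rewrite !mcoeffZ !mcoeffX toric_weight_mext.
have -> : (mext (toric_weight f m) (mdeg m) == mext m0 i) =
    (mdeg m == i) && (toric_weight f m == m0).
  by apply/eqP/andP=> [/mext_inj[-> ->]|[/eqP-> /eqP->]].
by case: (_ == i); rewrite ?mulr0.
Qed.

End FiberKernel.

(** * The Krull dimension of a toric ring *)

Lemma mpoly_split_var (k : fieldType) e (s : 'I_e) (G : {mpoly k[e]}) :
  exists G0 H, [/\ G = G0 + 'X_s * H,
    forall m, m \in msupp G0 -> m s = 0%N /\ m \in msupp G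
  & forall m, m \in msupp H -> (m + U_(s))%MM \in msupp G].
Proof.
exists (\sum_(m <- msupp G | m s == 0%N) G@_m *: 'X_[m]).
exists (\sum_(m <- msupp G | m s != 0%N) G@_m *: 'X_[(m - U_(s))%MM]).
split=> [|m|m].
- rewrite {1}[G]mpolyE (bigID (fun m : 'X_{1..e} => m s == 0%N)) /=;
  congr (_ + _).
  rewrite big_distrr /=; apply: eq_bigr => m ms.
  rewrite -scalerAr -mpolyXD addmC submK //; apply/mnm_lepP=> i.
  by rewrite mnm1E; case: eqP => // <-; rewrite lt0n.
- rewrite mcoeff_msupp raddf_sum /= => nz.
  have [ms|ms] := eqVneq (m s) 0%N; last first.
    case/eqP: nz; rewrite big1 // => m' /eqP ms'; rewrite mcoeffZ mcoeffX.
    by case: (m' =P m) ms => [<-|_ _]; rewrite ?ms' ?mulr0.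
  split=> //; apply: contraNT nz => mG; apply/eqP.
  rewrite big_seq_cond big1 // => m' /andP[m'G _]; rewrite mcoeffZ mcoeffX.
  by case: (m' =P m) mG => [<-|_ _]; rewrite ?m'G ?mulr0.
rewrite mcoeff_msupp raddf_sum /= => nz; apply: contraNT nz => mG; apply/eqP.
rewrite big_seq_cond big1 // => m' /andP[m'G ms]; rewrite mcoeffZ mcoeffX.
case: ((m' - U_(s))%MM =P m) mG => [<-|_ _]; rewrite ?mulr0 // submK ?m'G //.
by apply/mnm_lepP=> i; rewrite mnm1E; case: eqP => // <-; rewrite lt0n.
Qed.

(* Elements x_i of P_{i+1} outside P_i are algebraically independent modulo
   P_0: reducing a relation in P_i modulo P_{i+1} kills x_i, and a relation
   divisible by x_i can be divided by it. *)
Lemma prime_chain_alg_indep (k : fieldType) (B : comNzRingType) e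
    (P : 'I_e.+1 -> {pred B}) (ev : {rmorphism {mpoly k[e]} -> B}) :
    prime_chain P ->
    (forall i : 'I_e, ev 'X_i \in P (lift ord0 i) /\ ev 'X_i \notin P (inord
      i)) ->
  forall G, ev G \in P ord0 -> G = 0.
Proof.
move=> [primeP chainP] evX.
have PD i x y : x \in P i -> y \in P i -> x + y \in P i.
  by have [[_ _ H] _] := primeP i => xP yP; rewrite -[x]mul1r H.
have PM i x y : y \in P i -> x * y \in P i.
  by have [[P0 _ H] _] := primeP i => yP; rewrite -[_ * _]addr0 H.
have P1 i : 1 \notin P i by have [[_ ? _] _] := primeP i.
(* The claim concerns relations in [P s] among the variables of index at least [s]. The induction
   runs downwards on [s], starting from constants. *)
suff claim d : forall s : 'I_e.+1, (e - s <= d)%N -> forall G,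
    (forall m, m \in msupp G -> forall i : 'I_e, (i < s)%N -> m i = 0%N) ->
    ev G \in P s -> G = 0.
  by move=> G; apply: (claim e ord0); rewrite ?subn0.
elim: d => [|d IH] s hs G Gs GP.
  have se : s = e :> nat by apply/eqP;
    rewrite eqn_leq -ltnS ltn_ord -subn_eq0 -leqn0.
  have GC : G = (G@_0%MM)%:MP.
    apply/mpolyP=> m; rewrite mcoeffC; have [->|m0] := eqVneq m 0%MM;
      first by rewrite mulr1.
    rewrite mulr0; apply/eqP; rewrite -[_ == 0]negbK -mcoeff_msupp;
      apply/negP=> /Gs mG.
    by case/eqP: m0; apply/mnmP=> i; rewrite mnm0E mG // se.
  have [c0|c0] := eqVneq (G@_0%MM) 0; first by rewrite GC c0 mpolyC0.
  case/negP: (P1 s); rewrite -(rmorph1 ev) -mpolyC1 -(mulVf c0) mpolyCM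
    rmorphM -GC.
  exact: PM.
have [se|se] := eqVneq (s : nat) e.
  by apply: (IH s) => //; rewrite se subnn.
have lt_se : (s < e)%N by rewrite ltn_neqAle se -ltnS ltn_ord.
pose i := Ordinal lt_se.
have [X1 X0] := evX i.
have sE : s = inord i by apply: val_inj; rewrite /= inordK.
have sub : {subset P s <= P (lift ord0 i)} by case: (chainP s (lift ord0 i)).
(* Inner induction on the degree: [G0] is a relation in the next prime, hence 0, and the image of
   [X_i], being outside the prime [P s], can be cancelled from the rest. *)
have [D] := ubnP (\max_(m <- msupp G) mdeg m)%N.
elim: D G Gs GP => // D IHD G Gs GP; rewrite ltnS => hD.
have [G0 [H [GE G0s Hs]]] := mpoly_split_var i G.
have G00 : G0 = 0.
  apply: (IH (lift ord0 i)); first by rewrite /= /bump add1n; lia.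
    move=> m /G0s[mi mG] j; rewrite /= /bump add1n ltnS leq_eqVlt =>
      /orP[/eqP ji|].
      by have -> : j = i by apply: val_inj.
    exact: Gs.
  have -> : G0 = G + (- H) * 'X_i by rewrite GE mulNr [H * _]mulrC addrK.
  by rewrite rmorphD rmorphM; apply: PD; [exact: sub|exact: PM].
rewrite GE G00 add0r; suff -> : H = 0 by rewrite mulr0.
have [->//|H0] := eqVneq H 0.
apply: IHD.
- move=> m /Hs mG j js; have := Gs _ mG j js; rewrite mnmDE; lia.
- have := GP; rewrite GE G00 add0r rmorphM => XH.
  have [_ /(_ _ _ XH)/orP[|//]] := primeP s.
  by rewrite sE (negPf X0).
- have hd m : m \in msupp H -> (mdeg m < D)%N.
    move=> /Hs mG; apply: leq_trans hD.
    have := @leq_bigmax_seq _ (msupp G) predT (fun m : 'X_{1..e} =>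
      mdeg m) _ mG isT.
    by rewrite mdegD mdeg1 addn1.
  have D0 : (0 < D)%N by apply: leq_ltn_trans (hd _ (mlead_supp H0)).
  rewrite -(prednK D0) ltnS; apply/bigmax_leqP_seq => m mH _.
  by rewrite -ltnS (prednK D0) hd.
Qed.

(** * Algebraic independence bounded by counting monomials *)

Definition exps_leq (k : fieldType) r d (p : {mpoly k[r]}) :=
  forall m, m \in msupp p -> forall x, (m x <= d)%N.

Lemma exps_leqM (k : fieldType) r d d' (p q : {mpoly k[r]}) :
  exps_leq d p -> exps_leq d' q -> exps_leq (d + d') (p * q).
Proof.
move=> Hp Hq m /msuppM_le /allpairsP[[m1 m2] /= [m1p m2q ->]] x.
by rewrite mnmDE leq_add ?Hp ?Hq.
Qed.

Lemma exps_leqX (k : fieldType) r d (p : {mpoly k[r]}) i :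
  exps_leq d p -> exps_leq (i * d) (p ^+ i).
Proof.
move=> Hp; elim: i => [|i IH]; last by rewrite exprS mulSn; apply: exps_leqM.
by move=> m; rewrite expr0 msupp1 inE => /eqP-> x; rewrite mnm0E.
Qed.

Lemma exps_leqW (k : fieldType) r d d' (p : {mpoly k[r]}) :
  (d <= d')%N -> exps_leq d p -> exps_leq d' p.
Proof. by move=> dd' Hp m mp x; apply: leq_trans dd'; apply: Hp. Qed.

(** The monomials with exponents at most [N] in the entries of [z] are linearly independent, and
    they lie in the span of the monomials with exponents at most [e * (N * d)], where [d] bounds the
    degrees of the entries. *)
Lemma alg_indep_card (k : fieldType) e r (z : e.-tuple {mpoly k[r]}) :
    (forall G : {mpoly k[e]}, G \mPo z = 0 -> G = 0) ->
  exists d, forall N, (N.+1 ^ e <= (e * (N * d)).+1 ^ r)%N.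
Proof.
move=> indep; pose d := (\max_(i < e) \max_(m <- msupp (tnth z i)) mdeg m)%N.
exists d => N; pose M := (e * (N * d))%N.
have zd i : exps_leq d (tnth z i).
  move=> m mz x; apply: leq_trans (leq_bigmax i).
  apply: leq_trans (@leq_bigmax_seq _ _ predT _ _ mz isT).
  by rewrite mdegE (bigD1 x) //= leq_addr.
pose mn s c (g : {ffun 'I_s ->
  'I_c.+1}) : 'X_{1..s} := [multinom (g i : nat) | i < s].
have mn_inj s c : injective (@mn s c).
  move=> g g' E; apply/ffunP=> i; apply: val_inj.
  by have := congr1 (fun m : 'X_{1..s} => m i) E; rewrite !mnmE.
pose Z (g : {ffun 'I_e -> 'I_N.+1}) := 'X_[mn _ _ g] \mPo z.
have ZM g : exps_leq M (Z g).
  rewrite /Z comp_mpolyX /M -[X in (X * _)%N]card_ord -sum_nat_const.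
  elim/big_ind2: _ => [m|p d1 q d2|i _]; last 1 first.
  - apply: exps_leqW (exps_leqX (zd i)); rewrite leq_mul2r mnmE -ltnS ltn_ord.
    exact: orbT.
  - by rewrite msupp1 inE => /eqP-> x; rewrite mnm0E.
  - exact: exps_leqM.
pose C : 'M[k]_(#|{ffun 'I_e -> 'I_N.+1}|, #|{ffun 'I_r -> 'I_M.+1}|) :=
  \matrix_(a, b) (Z (enum_val a))@_(mn _ _ (enum_val b)).
have freeC : row_free C.
  apply: inj_row_free => v vC.
  pose G : {mpoly k[e]} := \sum_a v 0 a *: 'X_[mn _ _ (enum_val a)].
  have G0 : G = 0.
    apply: indep; rewrite /G raddf_sum /=; apply/mpolyP=> m;
      rewrite mcoeff0 raddf_sum /=.
    have [/forallP mM|] := boolP [forall x, m x <= M]%N.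
      pose b : {ffun 'I_r -> 'I_M.+1} := [ffun x => inord (m x)].
      have -> : m = mn _ _ b by apply/mnmP=> x; rewrite mnmE ffunE inordK ?ltnS.
      have := congr1 (fun w : 'rV_ _ => w 0 (enum_rank b)) vC;
        rewrite !mxE => E.
      rewrite -[RHS]E; apply: eq_bigr => a _.
      by rewrite comp_mpolyZ mcoeffZ mxE enum_rankK.
    rewrite negb_forall => /existsP[x mx]; rewrite big1 // => a _.
    rewrite comp_mpolyZ mcoeffZ; apply/eqP; rewrite mulf_eq0; apply/orP; right.
    by rewrite mcoeff_eq0; apply: contra mx => /ZM.
  apply/rowP=> a; rewrite mxE; have := congr1 (mcoeff (mn _ _ (enum_val a))) G0.
  rewrite mcoeff0 /G raddf_sum /= (bigD1 a) //= mcoeffZ mcoeffX eqxx mulr1.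
  rewrite big1 ?addr0 // => b ba; rewrite mcoeffZ mcoeffX.
  by case: eqP => [/mn_inj/enum_val_inj E|_]; rewrite ?mulr0 // E eqxx in ba *.
move: freeC; rewrite /row_free => /eqP rC.
by have := rank_leq_col C; rewrite rC !card_ffun !card_ord.
Qed.

Lemma alg_indep_leq (k : fieldType) e r (z : e.-tuple {mpoly k[r]}) :
  (forall G : {mpoly k[e]}, G \mPo z = 0 -> G = 0) -> (e <= r)%N.
Proof.
move=> /alg_indep_card[d H]; rewrite leqNgt; apply/negP=> re.
(* With this [N], the bound [((e d + 1) (N + 1))^r] equals [N (N + 1)^r], which is just below
   [(N + 1)^(r + 1)]. *)
pose N := ((e * d).+1 ^ r)%N.
have le1 : ((e * (N * d)).+1 <= (e * d).+1 * N.+1)%N by nia.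
have le2 : (N.+1 ^ r.+1 <= N.+1 ^ e)%N by rewrite leq_exp2l ?ltnS ?expn_gt0.
have := leq_trans le2 (H N); rewrite leqNgt => /negP[].
apply: leq_ltn_trans (_ : ((e * d).+1 * N.+1) ^ r < _)%N.
  by case: (r) => // r'; rewrite leq_exp2r.
by rewrite expnMn expnS ltn_pmul2r ?expn_gt0.
Qed.

Lemma toric_ker_sub (k : fieldType) t N N' (h : 'I_t -> 'X_{1..N})
    (h' : 'I_t -> 'X_{1..N'}) (p : {mpoly k[t]}) :
    (forall u v, toric_weight h u = toric_weight h v ->
                 toric_weight h' u = toric_weight h' v) ->
  toric h p = 0 -> toric h' p = 0.
Proof.
move=> H p0; pose S : {pred {mpoly k[t]}} := fun q => `[< toric h' q = 0 >].
have : p \in ideal_gen S.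
  apply: toric_ker_binomials p0 => u v /H E; apply: ideal_gen_mem.
  by apply/asboolP/eqP; rewrite toric_binomial E.
move: p {p0}; apply: ideal_gen_ind => [|x y x0 y0|a x /asboolP x0].
- exact: raddf0.
- by rewrite raddfD /= x0 y0 addr0.
- by rewrite rmorphM /= x0 mulr0.
Qed.

(** * Chains of toric primes *)

Section KrullDim.
Variables (k : fieldType) (t : nat) (B : comNzRingType).
Variable pi : {rmorphism {mpoly k[t]} -> B}.
Hypothesis pi_surj : forall b, exists p, pi p = b.

Section Full.
Variables (r : nat) (h : 'I_t -> 'X_{1..r}).
Hypothesis pi_ker : forall p, (pi p == 0) = (toric h p == 0).
(** Full rank in integral form: a nonzero multiple of each unit vector is a difference of two
    weights. It makes the truncations give strict inclusions. *)
Hypothesis h_full : forall x : 'I_r, exists u v,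
  toric_weight h u x != toric_weight h v x /\
  forall y, y != x -> toric_weight h u y = toric_weight h v y.

(* Amounts to setting the variables of index at least s to 1. *)
Definition truncate s j : 'X_{1..r} :=
  [multinom if (x < s)%N then h j x else 0%N | x < r].

Lemma toric_weight_truncate s u (x : 'I_r) :
  toric_weight (truncate s) u x = if (x < s)%N then toric_weight h u x else 0%N.
Proof.
rewrite !mnmE; case: ifP => xs.
  by apply: eq_bigr => j _; rewrite mnmE xs.
by rewrite big1 // => j _; rewrite mnmE xs.
Qed.

(** Fewer variables survive as [i] grows, so the ideals increase; index 0 gives the zero ideal. *)
Definition truncate_ideal (i : 'I_r.+1) : {pred B} := fun b =>
  `[< exists2 p, pi p = b & toric (truncate (r - i)) p = 0 >].

Lemma mem_truncate_ideal i p :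
  (pi p \in truncate_ideal i) = (toric (truncate (r - i)) p == 0).
Proof.
apply/asboolP/eqP=> [[q /eqP E q0]|p0]; last by exists p.
have : toric h (p - q) = 0 by apply/eqP;
  rewrite -pi_ker raddfB /= subr_eq0 eq_sym.
move/(toric_ker_sub (h' := truncate (r - i))); rewrite raddfB /= q0 subr0;
  apply.
move=> u v uv; apply/mnmP=> x; rewrite !toric_weight_truncate.
by move/mnmP: uv => /(_ x) ->.
Qed.

Lemma truncate_chain : prime_chain truncate_ideal.
Proof.
split=> [i|i j ij].
  split; first split.
  - by rewrite -(raddf0 pi) mem_truncate_ideal raddf0.
  - by rewrite -(rmorph1 pi) mem_truncate_ideal rmorph1 oner_eq0.
  - move=> a b c; have [p <-] := pi_surj a; have [q <-] := pi_surj b.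
    have [s <-] := pi_surj c; rewrite -rmorphM -rmorphD !mem_truncate_ideal.
    by move=> /eqP q0 /eqP s0; rewrite rmorphD rmorphM /= q0 s0 mulr0 addr0.
  - move=> a b; have [p <-] := pi_surj a; have [q <-] := pi_surj b.
    by rewrite -rmorphM !mem_truncate_ideal rmorphM mulf_eq0.
split=> [b|sub].
  have [p <-] := pi_surj b; rewrite !mem_truncate_ideal => /eqP p0; apply/eqP.
  apply: toric_ker_sub p0 => u v /mnmP uv; apply/mnmP=> x.
  have := uv x; rewrite !toric_weight_truncate; case: ifP => xi;
    case: ifP => // xj.
  by move: xi xj ij; lia.
have lt_jr : (r - j < r)%N by have := ltn_ord j; lia.
have [u [v [uvx uvy]]] := h_full (Ordinal lt_jr).
have : pi ('X_[u] - 'X_[v]) \in truncate_ideal j.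
  rewrite mem_truncate_ideal toric_binomial; apply/eqP/mnmP=> x.
  rewrite !toric_weight_truncate; case: ifP => // xj; apply: uvy.
  by apply: contraTneq xj => ->; rewrite /= ltnn.
move/sub; rewrite mem_truncate_ideal toric_binomial =>
  /eqP/mnmP/(_ (Ordinal lt_jr)).
rewrite !toric_weight_truncate /=; case: ifP => [_ E|];
  first by rewrite E eqxx in uvx.
by move: ij (ltn_ord j); lia.
Qed.

(** For the upper bound, elements climbing a chain of primes lift to polynomials whose toric images
    are algebraically independent: a relation between these gives 0 in [B], which lies in the first
    prime. *)
Lemma krull_dim_toric_full : krull_dim B r.
Proof.
split=> [|e P chainP]; first by exists truncate_ideal; apply: truncate_chain.
have [primeP strictP] := chainP.
have /fin_all_exists[x xP] (i : 'I_e) :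
    exists x, pi x \in P (lift ord0 i) /\ pi x \notin P (inord i).
  have lt : ((inord i : 'I_e.+1) < lift ord0 i)%N.
    by rewrite inordK ?(leqW (ltn_ord i)) //= /bump add1n.
  have [_ nsub] := strictP _ _ lt.
  apply/not_existsP => none; apply: nsub => b; have [p <-] := pi_surj b.
  by move=> pP; apply/negPn/negP=> npP; apply: (none p).
pose X := [tuple x i | i < e].
apply: (alg_indep_leq (z := [tuple toric h (x i) | i < e])) => G G0.
pose ev : {rmorphism {mpoly k[e]} -> B} := pi \o (comp_mpoly X).
apply: (prime_chain_alg_indep (ev := ev) chainP).
  by move=> i; rewrite /= comp_mpolyXU -tnth_nth tnth_mktuple.
suff -> : ev G = 0 by have [[? _ _] _] := primeP ord0.
apply/eqP; rewrite /= pi_ker; apply/eqP; rewrite -[RHS]G0.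
rewrite !comp_mpolyEX raddf_sum /=; apply: eq_bigr => m _.
rewrite linearZ /= !comp_mpolyX rmorph_prod /=; congr (_ *: _).
by apply: eq_bigr => i _; rewrite rmorphXn /= !tnth_mktuple.
Qed.

End Full.

(** Only [r] independent coordinates of the exponent vectors are kept. The others are rational
    combinations of them, so the kernel is unchanged and the exponents stay natural numbers. *)
Lemma krull_dim_toric N (h : 'I_t -> 'X_{1..N}) :
    (forall p, (pi p == 0) = (toric h p == 0)) ->
  krull_dim B (rk (toric_vec h) [set: 'I_t]).
Proof.
move=> pi_ker; pose A : 'M[rat]_(t, N) := \matrix_(j, x) (h j x)%:R.
have -> : rk (toric_vec h) [set: 'I_t] = \rank A^T.
  rewrite mxrank_tr /rk; apply/eqP; rewrite eqn_leq; apply/andP; split;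
    apply: mxrankS.
    apply: span_subP => j _; have ->
      : toric_vec h j = row j A by apply/rowP=> x; rewrite !mxE.
    exact: row_sub.
  apply/row_subP=> j; have -> : row j A = toric_vec h j by apply/rowP=> x;
    rewrite !mxE.
  by rewrite span_sub.
set r := \rank A^T; pose s : 'I_r -> 'I_N := maxrankfun A^T.
pose h' j : 'X_{1..r} := [multinom h j (s x) | x < r].
have weightE u x : toric_weight h' u x = toric_weight h u (s x).
  by rewrite !mnmE; apply: eq_bigr => j _; rewrite mnmE.
have wA u x : (toric_weight h u x)%:R = \sum_j A^T x j * (u j)%:R.
  by rewrite mnmE natr_sum; apply: eq_bigr => j _; rewrite natrM !mxE.
apply: (@krull_dim_toric_full r h').
  move=> p; rewrite pi_ker; apply/eqP/eqP; apply: toric_ker_sub => u v uv.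
    by apply/mnmP=> x; rewrite !weightE uv.
  apply/mnmP=> x; apply/eqP; rewrite -(eqr_nat rat) !wA.
  have /submxP[D DE] : (row x A^T <= rowsub s A^T)%MS.
    by rewrite eq_maxrowsub row_sub.
  have E j : A^T x j = \sum_i D 0 i * A^T (s i) j.
    have := congr1 (fun M : 'rV_t => M 0 j) DE; rewrite !mxE => ->.
    by apply: eq_bigr => i _; rewrite !mxE.
  have W w : \sum_j A^T x j * w j = \sum_i D 0 i * \sum_j A^T (s i) j * w j.
    under eq_bigr do rewrite E mulr_suml.
    rewrite exchange_big /=; apply: eq_bigr => i _; rewrite mulr_sumr.
    by apply: eq_bigr => j _; rewrite mulrA.
  rewrite !W; apply/eqP/eq_bigr => i _; congr (_ * _).
  by rewrite -!wA -!weightE uv.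
move=> x.
(* Column [x] of a right inverse, with denominators cleared, gives two exponent vectors whose
   weights differ only at [x]. *)
have /row_freeP[C CE] : row_free (rowsub s A^T) by apply: maxrowsub_free.
have cE y : \sum_j A^T (s y) j * C j x = (y == x)%:R.
  have := congr1 (fun M : 'M_r => M y x) CE; rewrite !mxE => <-.
  by apply: eq_bigr => j _; rewrite !mxE.
have [d [u [v [d_gt0 uvE]]]] := common_denominator (fun j => C j x).
pose u' := [multinom u j | j < t]; pose v' := [multinom v j | j < t].
have diff y : (toric_weight h' u' y)%:R - (toric_weight h' v' y)%:R = d%:R *
  (y == x)%:R :> rat.
  rewrite !weightE !wA -sumrB -cE mulr_sumr; apply: eq_bigr => j _.
  by rewrite -mulrBr !mnmE -uvE mulrCA.
exists u', v'; split=> [|y yx].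
  by rewrite -(eqr_nat rat) -subr_eq0 diff eqxx mulr1 pnatr_eq0 -lt0n.
by apply/eqP; rewrite -(eqr_nat rat) -subr_eq0 diff (negPf yx) mulr0.
Qed.

End KrullDim.

(** * Numbers of generators *)

Lemma krull_dim_uniq (B : comNzRingType) d d' : krull_dim B d ->
  krull_dim B d' -> d = d'.
Proof.
move=> [[P chP] max_d] [[P' chP'] max_d']; apply/eqP.
by rewrite eqn_leq (max_d' _ _ chP) (max_d _ _ chP').
Qed.

Lemma min_num_gens_uniq (A : comNzRingType) (J : {pred A}) r r' :
  min_num_gens J r -> min_num_gens J r' -> r = r'.
Proof. by move=> [gr mr] [gr' mr']; apply/eqP; rewrite eqn_leq mr ?mr'. Qed.

Lemma ideal_gen_tuple (A : comNzRingType) s (g : s.-tuple A) p :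
  p \in ideal_gen (mem g) -> exists c : 'I_s -> A, p = \sum_i c i * tnth g i.
Proof.
move: p; apply: ideal_gen_ind => [|x y [c ->] [d ->]|a _ /tnthP[j ->]].
- by exists (fun _ => 0); rewrite big1 // => i _; rewrite mul0r.
- exists (fun i => c i + d i); rewrite -big_split.
  by apply: eq_bigr => i _; rewrite mulrDl.
exists (fun i => if i == j then a else 0); rewrite (bigD1 j) //= eqxx.
by rewrite big1 ?addr0 // => i /negPf->; rewrite mul0r.
Qed.

(** Nakayama's argument in matrix form. No element of [J] has a monomial of weight below [D], so in
    weight [D] only the constant terms of the coefficients contribute, and the identity matrix of
    size [size L] factors through dimension [s]. *)
Lemma min_num_gens_monomials (k : fieldType) n (a : 'I_n -> nat) D
    (L : seq 'X_{1..n}) (J : {pred {mpoly k[n]}}) :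
    (forall i, (0 < a i)%N) -> uniq L -> {in L, forall m, wdeg a m = D} ->
    J =i ideal_gen (mem [seq ('X_[m] : {mpoly k[n]}) | m <- L]) ->
  min_num_gens J (size L).
Proof.
move=> a_gt0 L_uniq LD JE; split.
  by exists (map_tuple (fun m => 'X_[m]) (in_tuple L)).
move=> s [g Jg].
have JD x : x \in J -> wdeg_ge a D x.
  rewrite JE; move: x; apply: wdeg_ge_ideal_gen => _ /mapP[m mL ->].
  by apply: wdeg_geX; rewrite LD.
pose lm (b : 'I_(size L)) := tnth (in_tuple L) b.
have lmL b : lm b \in L by apply: mem_tnth.
have lm_inj : injective lm.
  move=> b b'; rewrite /lm !(tnth_nth 0%MM) => /eqP.
  by rewrite nth_uniq // => /eqP/val_inj.
have /fin_all_exists[c cE] (b : 'I_(size L)) : exists c : 'I_s -> {mpoly k[n]},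
    'X_[lm b] = \sum_i c i * tnth g i.
  apply: ideal_gen_tuple; rewrite -Jg JE; apply: ideal_gen_mem.
  by apply/mapP; exists (lm b).
pose C := \matrix_(b < size L, i < s) (c b i)@_0%MM.
pose G := \matrix_(i < s, b < size L) (tnth g i)@_(lm b).
apply: (@mulmx1_min _ _ _ C G); apply/matrixP=> b b'; rewrite !mxE.
have := congr1 (mcoeff (lm b')) (cE b);
  rewrite mcoeffX raddf_sum /= (inj_eq lm_inj) => ->.
apply: eq_bigr => i _; rewrite !mxE.
set c0 := (c b i)@_0%MM.
suff Z : ((c b i - c0%:MP) * tnth g i)@_(lm b') = 0.
  by rewrite -[in RHS](subrK c0%:MP (c b i)) mulrDl mcoeffD mcoeffCM Z add0r.
apply/eqP/negPn/negP=> nz.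
suff : (1 + D <= wdeg a (lm b'))%N by rewrite LD // ltnn.
apply: wdeg_geM nz; last by apply: JD; rewrite Jg; apply/ideal_gen_mem/mem_tnth.
move=> m; have [->|m0 _] := eqVneq m 0%MM.
  by rewrite mcoeffB mcoeffC eqxx mulr1 subrr eqxx.
by rewrite lt0n; apply: contra m0 => /eqP/(wdeg_eq0 a_gt0)->.
Qed.

Lemma freiman_formula l t mu : (l <= t)%N ->
  (mu%:Z = l%:Z * t%:Z - 'C(l, 2)%:Z) <-> (mu + 'C((t - l).+1, 2) = 'C(t.+1,
    2))%N.
Proof.
move=> /subnK <-; move: (t - l)%N => d; rewrite addnK.
have E : (l * (d + l) + 'C(d.+1, 2) = 'C((d + l).+1, 2) + 'C(l, 2))%N.
  elim: l => [|l IH]; first by rewrite addn0 addn0.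
  by rewrite addnS (binS (d + l).+1) (binS l) !bin1; lia.
split=> H; lia.
Qed.

Section Freiman.
Variables (k : fieldType) (n t : nat) (f : 'I_t -> 'X_{1..n}).
Local Notation I := (monomial_ideal k f).
Local Notation h := (fun j => mext (f j) 1).

Lemma minimal_generators_inj : minimal_generators k f -> injective f.
Proof.
move=> min_f i j E; apply/eqP/negPn/negP => ij.
by case/negP: (min_f j); rewrite -E; apply/ideal_gen_mem/image_f.
Qed.

Lemma min_num_gens_I : injective f -> quasi_equigenerated f -> min_num_gens I t.
Proof.
move=> f_inj /quasi_equigenerated_wdeg[a a_gt0 [D fD]].
rewrite -{2}(card_ord t) -(size_codom f).
apply: (min_num_gens_monomials (a := a) (D := D)) => //.
- by rewrite map_inj_uniq ?enum_uniq.
- by move=> _ /codomP[j ->].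
by rewrite /codom /image_mem -map_comp.
Qed.

Lemma min_num_gens_I2 : injective f -> quasi_equigenerated f ->
  min_num_gens (idealX I 2) #|sumset (toric_vec h) [set: 'I_t]|.
Proof.
move=> f_inj /quasi_equigenerated_wdeg[a a_gt0 [D fD]].
pose C z := sum_class (toric_vec h) z.1 z.2.
pose F (z : 'I_t * 'I_t) := (f z.1 + f z.2)%MM.
(* The last coordinate of every sum is 2 and does not affect coincidences. *)
have CF z z' : C z = C z' <-> F z = F z'.
  rewrite /C sum_classP; split=> E.
    apply/mnmP=> y; have := congr1 (fun M : 'rV_n.+1 => M 0 (lift ord_max y)) E.
    rewrite !mxE -!natrD => /eqP; rewrite eqr_nat !mext_lift => /eqP.
    by rewrite !mnmDE.
  apply/rowP=> x; rewrite !mxE -!natrD; congr _%:R.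
  have [y ->|->] := unliftP ord_max x; last by rewrite !mext_max.
  by rewrite !mext_lift -!mnmDE -/(F z) E.
(* One pair for each sum, the one that [pick] selects, so that the list of products has no
   repetition. *)
pose R := [set z | [pick y | C y == C z] == Some z].
have R_ex z : exists2 z', z' \in R & C z' = C z.
  case E: [pick y | C y == C z] => [z'|]; last first.
    by move: E; case: pickP => // /(_ z); rewrite eqxx.
  have CE : C z' = C z by move: E; case: pickP => // y /eqP <- [<-].
  by exists z' => //; rewrite inE -E; apply/eqP; apply: eq_pick => y;
    rewrite CE.
have C_inj : {in R &, injective C}.
  move=> z z'; rewrite !inE => /eqP zR /eqP zR' E.
  by apply: Some_inj; rewrite -zR -zR'; apply: eq_pick => y; rewrite E.
have -> : #|sumset (toric_vec h) [set: 'I_t]| = size [seq F z | z <- enum R].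
  rewrite size_map -cardE -(card_in_imset C_inj); congr #|pred_of_set _|.
  apply/setP=> c; apply/imset2P/imsetP=> [[i j _ _ ->]|[z _ ->]].
    by have [z zR E] := R_ex (i, j); exists z; rewrite ?E.
  by exists z.1 z.2; rewrite ?inE.
apply: (min_num_gens_monomials (a := a) (D := (D + D)%N)) => //.
- rewrite map_inj_in_uniq ?enum_uniq // => z z';
  rewrite !mem_enum => zR zR' /CF.
  exact: C_inj.
- by move=> _ /mapP[z _ ->]; rewrite wdegD !fD.
set J := ideal_gen _.
have FJ z : 'X_[F z] \in J.
  have [z' zR /CF <-] := R_ex z; apply: ideal_gen_mem; rewrite -map_comp.
  by apply/mapP; exists z'; rewrite ?mem_enum.
have IIJ x y : x \in I -> y \in I -> x * y \in J.
  move=> + yI; move: x; apply: ideal_gen_ind => [|x1 x2|b _ /codomP[i ->]].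
  - by rewrite mul0r ideal_gen0.
  - by rewrite mulrDl; apply: ideal_genD.
  rewrite -mulrA; apply: ideal_genMl; move: y yI.
  apply: ideal_gen_ind => [|y1 y2|d _ /codomP[j ->]].
  - by rewrite mulr0 ideal_gen0.
  - by rewrite mulrDr; apply: ideal_genD.
  rewrite mulrCA; apply: ideal_genMl; rewrite -mpolyXD; exact: (FJ (i, j)).
have I1 y : y \in idealX I 1 -> y \in I.
  move: y; apply: ideal_gen_ind => [|y1 y2|b _ /asboolP[x xI [y _ ->]]].
  - exact: ideal_gen0.
  - exact: ideal_genD.
  by rewrite mulrCA mulrC; apply: ideal_genMl.
move=> x; apply/idP/idP; move: x; apply: ideal_gen_ind.
- exact: ideal_gen0.
- exact: ideal_genD.
- move=> b _ /asboolP[x xI [y yI ->]]; apply: ideal_genMl.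
  by apply: IIJ => //; apply: I1.
- exact: idealX_0.
- exact: idealX_add.
move=> b _ /mapP[_ /mapP[z _ ->] ->]; apply: idealX_mulr; rewrite mpolyXD.
by apply: (@idealX_mul _ I 1 1); apply/idealX1_mem/monomial_ideal_gen.
Qed.

Lemma analytic_spread_rk : quasi_equigenerated f ->
  analytic_spread I (rk (toric_vec h) [set: 'I_t]).
Proof.
move=> qe; pose pi : {rmorphism {mpoly k[t]} ->
  fiber_cone I} := @fiber_map k n t f.
apply: (@krull_dim_toric k t _ pi) => [|p]; first exact: fiber_map_surj.
exact: fiber_map_eq0.
Qed.

Lemma freimanP : injective f -> quasi_equigenerated f ->
  freiman k f <-> freiman_set (toric_vec h) [set: 'I_t].
Proof.
move=> f_inj qe; have lI := analytic_spread_rk qe.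
have m1 := min_num_gens_I f_inj qe; have m2 := min_num_gens_I2 f_inj qe.
have le_rk := rk_le_card (toric_vec h) [set: 'I_t].
rewrite /freiman_set /defect cardsT card_ord in le_rk *.
rewrite -(freiman_formula _ le_rk);
  split=> [[_ [l [mu1 [mu2 [H1 H2 H3 H4]]]]]|E].
  by rewrite (min_num_gens_uniq m2 H3) H4 (min_num_gens_uniq H2 m1)
    (krull_dim_uniq H1 lI).
by split=> //; exists (rk (toric_vec h) [set: 'I_t]), t,
  #|sumset (toric_vec h) [set: 'I_t]|.
Qed.

End Freiman.

Theorem theorem4p6 (k : fieldType) (n t : nat) (f : 'I_t -> 'X_{1..n}) :
  minimal_generators k f ->
  squarefree_monomials f ->
  quasi_equigenerated f ->
  freiman k f <->
  (defining_ideal k f =i pred1 0) \/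
  (exists m : nat, (2 <= m)%N /\
     exists M : 'M[{mpoly k[t]}]_(2, m),
       generic_matrix M /\ defining_ideal k f =i ideal_gen (minors2 M)).
Proof.
move=> /minimal_generators_inj f_inj sqf qe.
have kerE (p : {mpoly k[t]}) :
    (p \in defining_ideal k f) = (toric (fun j => mext (f j) 1) p == 0).
  exact: fiber_map_eq0.
have h_inj : injective (fun j => mext (f j) 1) by move=> i j /mext_inj[/f_inj].
have h01 j i : (mext (f j) 1 i <= 1)%N.
  by have [y ->|->] := unliftP ord_max i; rewrite ?mext_max ?mext_lift.
rewrite (freimanP k f_inj qe) (freiman_toric k h_inj h01).
split=> -[H|[m [m2 [M [gM H]]]]].
- by left=> p; rewrite kerE H.
- by right; exists m; split=> //; exists M; split=> // p; rewrite kerE H.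
- by left=> p; rewrite -kerE H.
- by right; exists m; split=> //; exists M; split=> // p; rewrite -kerE H.
Qed.
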